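(* Let $T$ be a Hopf monad on an autonomous category $\mathcal{C}$ and let $Q$ be an endofunctor of $T\text{-}\mathcal{C}$. Assume the cross product $Q\rtimes T$ is centralizable, with centralizer $(Z_{Q\rtimes T},\partial)$. Then: (a) The centralizer of $Q\rtimes T$ lifts uniquely to a centralizer of $Q$. More precisely, $Q$ admits a unique centralizer $(Z_Q,\widetilde\partial)$ such that $U_TZ_Q=Z_{Q\rtimes T}U_T$ and $$\widetilde\partial_{(M,r),(N,s)}=(Q(s)\otimes\mathrm{id}_{Z_{Q\rtimes T}(M)})\,\partial_{M,N}$$ for all $T$-modules $(M,r)$ and $(N,s)$. (b) If $Q$ is comonoidal, the monad $Z_Q$ is a lift of the monad $Z_{Q\rtimes T}$ to $T\text{-}\mathcal{C}$. (c) If $Q$ is a bimonad, the bimonad $Z_Q$ is a lift of the bimonad $Z_{Q\rtimes T}$ to $T\text{-}\mathcal{C}$.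
   Context: Categories are small and monoidal categories are strict, with product $\otimes$ and unit $\mathbf 1$. A monoidal category is autonomous if every object $X$ has a left dual ${}^\vee X$ (with $\mathrm{ev}_X\colon {}^\vee X\otimes X\to\mathbf 1$, $\mathrm{coev}_X\colon \mathbf 1\to X\otimes {}^\vee X$) and a right dual $X^\vee$ (with $\widetilde{\mathrm{ev}}_X\colon X\otimes X^\vee\to \mathbf 1$, $\widetilde{\mathrm{coev}}_X\colon \mathbf 1\to X^\vee\otimes X$). Duals are chosen; ${}^\vee f$, $f^\vee$ are dual morphisms. A comonoidal functor $F$ is a functor with a coassociative and counital natural transformation $F_2(X,Y)\colon F(X\otimes Y)\to F(X)\otimes F(Y)$, $F_0\colon F(\mathbf 1)\to\mathbf 1$. Comonoidal natural transformations are those compatible with these structures; composites are comonoidal by $(GF)_2(X,Y)=G_2(F(X),F(Y))G(F_2(X,Y))$, $(GF)_0=G_0G(F_0)$. A bimonad is a monad $(T,\mu,\eta)$ with a comonoidal structure on $T$ such that $\mu,\eta$ are comonoidal. A left antipode for $T$ is a natural transformation $s^l_X\colon T({}^\vee T(X))\to {}^\vee X$ with $T_0T(\mathrm{ev}_X)T({}^\vee\eta_X\otimes \mathrm{id}_X)=\mathrm{ev}_{T(X)}(s^l_{T(X)}T({}^\vee\mu_X)\otimes \mathrm{id})T_2({}^\vee T(X),X)$ and $(\eta_X\otimes \mathrm{id}_{{}^\vee X})\mathrm{coev}_XT_0=(\mu_X\otimes s^l_X)T_2(T(X),{}^\vee T(X))T(\mathrm{coev}_{T(X)})$. A right antipode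 is a natural transformation $s^r_X\colon T(T(X)^\vee)\to X^\vee$ with $T_0T(\widetilde{\mathrm{ev}}_X)T(\mathrm{id}_X\otimes\eta_X^\vee)=\widetilde{\mathrm{ev}}_{T(X)}(\mathrm{id}\otimes s^r_{T(X)}T(\mu_X^\vee))T_2(X,T(X)^\vee)$ and $(\mathrm{id}_{X^\vee}\otimes\eta_X)\widetilde{\mathrm{coev}}_XT_0=(s^r_X\otimes\mu_X)T_2(T(X)^\vee,T(X))T(\widetilde{\mathrm{coev}}_{T(X)})$. A Hopf monad is a bimonad on an autonomous category having a left and a right antipode. For a monad $T$, $T\text{-}\mathcal{C}$ is the category of $T$-modules $(M,r)$ ($r\colon T(M)\to M$, $rT(r)=r\mu_M$, $r\eta_M=\mathrm{id}_M$) and $T$-linear morphisms; $U_T$ is the forgetful functor, $F_T(X)=(T(X),\mu_X)$ its left adjoint, with unit $\eta$ and counit $\varepsilon_{(M,r)}=r$. If $T$ is a bimonad, $T\text{-}\mathcal{C}$ is monoidal with $(M,r)\otimes(N,s)=(M\otimes N,(r\otimes s)T_2(M,N))$ and unit $(\mathbf 1,T_0)$, and $U_T$ is strict monoidal; if $T$ is a Hopf monad, $T\text{-}\mathcal{C}$ is autonomous. Cross product: $Q\rtimes T=U_TQF_T$, an endofunctor of $\mathcal{C}$. If $(Q,q,v)$ is a monad, $Q\rtimes T$ is a monad with product $q_{F_T}Q(\varepsilon_{QF_T})$ and unit $v_{F_T}\eta$. If $T$ is a bimonad and $Q$ is comonoidal, $Q\rtimes T$ is comonoidal with $(Q\rtimes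 T)_2(X,Y)=Q_2(F_T(X),F_T(Y))\,Q(\varepsilon_{F_T(X)\otimes F_T(Y)}F_T(\eta_X\otimes\eta_Y))$, $(Q\rtimes T)_0=Q_0Q(\varepsilon_{(\mathbf 1,T_0)})$. If $Q$ and $T$ are bimonads, so is $Q\rtimes T$. For a $T$-module $(N,s)$, $Q(s)\colon QF_T(N)\to Q(N,s)$ is $Q$ applied to the $T$-linear morphism $s\colon F_T(N)\to(N,s)$. A centralizer of an endofunctor $P$ of a monoidal category $\mathcal{A}$ is a pair $(Z_P,\partial)$ with $Z_P$ an endofunctor of $\mathcal{A}$ and $\partial_{X,Y}\colon X\otimes Y\to P(Y)\otimes Z_P(X)$ natural in $X,Y$, such that for all objects $X,W$ and every natural $\{\xi_Y\colon X\otimes Y\to P(Y)\otimes W\}_Y$ there is a unique $r\colon Z_P(X)\to W$ with $\xi_Y=(\mathrm{id}_{P(Y)}\otimes r)\partial_{X,Y}$ for all $Y$. $P$ is centralizable if it has a centralizer. When $\mathcal{A}$ is left autonomous: if $P$ is comonoidal, $Z_P$ is a monad with product $m$ and unit $u$ determined by $(\mathrm{id}\otimes m_X)(\mathrm{id}_{P(Y_1)}\otimes\partial_{Z_P(X),Y_2})(\partial_{X,Y_1}\otimes\mathrm{id}_{Y_2})=(P_2(Y_1,Y_2)\otimes\mathrm{id}_{Z_P(X)})\partial_{X,Y_1\otimes Y_2}$, $u_X=(P_0\otimes\mathrm{id}_{Z_P(X)})\partial_{X,\mathbf 1}$; if $P$ is a bimonad with product $\mu$ and unit $\eta$, $Z_P$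 is a bimonad with comonoidal structure determined by $(\mathrm{id}_{P(Y)}\otimes(Z_P)_2(X_1,X_2))\partial_{X_1\otimes X_2,Y}=(\mu_Y\otimes\mathrm{id})(\partial_{X_1,P(Y)}\otimes\mathrm{id}_{Z_P(X_2)})(\mathrm{id}_{X_1}\otimes\partial_{X_2,Y})$, $(\mathrm{id}_{P(Y)}\otimes(Z_P)_0)\partial_{\mathbf 1,Y}=\eta_Y$. A lift of a monad $(P,m,u)$ on $\mathcal{C}$ to $T\text{-}\mathcal{C}$ is a monad $(\widetilde P,\widetilde m,\widetilde u)$ on $T\text{-}\mathcal{C}$ with $PU_T=U_T\widetilde P$, $m_{U_T}=U_T(\widetilde m)$, $u_{U_T}=U_T(\widetilde u)$. A lift of a bimonad is a bimonad $\widetilde P$ that is a lift of the underlying monad such that $U_T\widetilde P=PU_T$ as comonoidal functors. *)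

(* Defs.v *)
From Corelib Require Import ssreflect.
From Stdlib Require Import ProofIrrelevance.

Set Implicit Arguments.
Unset Strict Implicit.
Unset Printing Implicit Defensive.

Declare Scope cat_scope.
Delimit Scope cat_scope with cat.
Local Open Scope cat_scope.

Record Category := {
  Ob :> Type;
  Hom : Ob -> Ob -> Type;
  idm : forall X, Hom X X;
  comp : forall X Y Z, Hom Y Z -> Hom X Y -> Hom X Z;
  compA : forall X Y Z W (h : Hom Z W) (g : Hom Y Z) (f : Hom X Y),
    comp h (comp g f) = comp (comp h g) f;
  comp1m : forall X Y (f : Hom X Y), comp (idm Y) f = f;
  compm1 : forall X Y (f : Hom X Y), comp f (idm X) = f }.

Arguments Hom {c} _ _.
Arguments idm {c} X.
Arguments comp {c X Y Z} _ _.
Notation "g ∘ f" := (comp g f) (at level 40, left associativity) : cat_scope.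

Record Functor (C D : Category) := {
  fobj :> C -> D;
  fmap : forall X Y : C, Hom X Y -> Hom (fobj X) (fobj Y);
  fmap1 : forall X, fmap (idm X) = idm (fobj X);
  fmapM : forall X Y Z (g : Hom Y Z) (f : Hom X Y),
    fmap (g ∘ f) = fmap g ∘ fmap f }.

Arguments fmap {C D} _ {X Y} _.

Definition idF (C : Category) : Functor C C :=
  {| fobj := fun X => X; fmap := fun _ _ f => f;
     fmap1 := fun _ => eq_refl; fmapM := fun _ _ _ _ _ => eq_refl |}.

Definition compF (C D E : Category) (G : Functor D E) (F : Functor C D) :
  Functor C E.
Proof.
refine {| fobj := fun X => G (F X); fmap := fun X Y f => fmap G (fmap F f) |}.
- abstract (by move=> X; rewrite !fmap1).
- abstract (by move=> X Y Z g f; rewrite !fmapM).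
Defined.

Notation "G ∘F F" := (compF G F) (at level 40, left associativity) : cat_scope.

Record Nat (C D : Category) (F G : Functor C D) := {
  nat_at :> forall X, Hom (F X) (G X);
  nat_nat : forall X Y (f : Hom X Y), fmap G f ∘ nat_at X = nat_at Y ∘ fmap F f }.

(** An equality of objects, seen as a morphism.  Morphisms [eqh e] are the
    identities that are left implicit on paper when two objects are equal but
    not convertible. *)
Definition eqh (C : Category) (X Y : C) (e : X = Y) : Hom X Y :=
  match e with eq_refl => idm X end.

Definition eqF (C D : Category) (F G : Functor C D) (e : F = G) (X : C) :
  Hom (F X) (G X) :=
  eqh (f_equal (fun K : Functor C D => fobj K X) e).

Section CatFacts.
Context {C : Category}.

Lemma eqh_id (X : C) (e : X = X) : eqh e = idm X.
Proof. by rewrite (proof_irrelevance _ e eq_refl). Qed.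

Lemma eqh_irr (X Y : C) (e e' : X = Y) : eqh e = eqh e'.
Proof. by rewrite (proof_irrelevance _ e e'). Qed.

Lemma eqhM (X Y Z : C) (e' : Y = Z) (e : X = Y) :
  eqh e' ∘ eqh e = eqh (eq_trans e e').
Proof. by destruct e'; rewrite /= comp1m. Qed.

Lemma eqhK (X Y : C) (e : X = Y) (e' : Y = X) : eqh e' ∘ eqh e = idm X.
Proof. by rewrite eqhM eqh_id. Qed.

Lemma fmap_eqh (D : Category) (F : Functor C D) (X Y : C) (e : X = Y) :
  fmap F (eqh e) = eqh (f_equal (fobj F) e).
Proof. by destruct e; rewrite /= fmap1. Qed.

Lemma compr (X Y Z Y' W : C) (g : Hom Y Z) (f : Hom X Y) (g' : Hom Y' Z)
    (f' : Hom X Y') (h : Hom Z W) :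
  g ∘ f = g' ∘ f' -> h ∘ g ∘ f = h ∘ g' ∘ f'.
Proof. by rewrite -!compA => ->. Qed.

Lemma comprr (X Y Z W : C) (g : Hom Y Z) (f : Hom X Y) k (h : Hom Z W) :
  g ∘ f = k -> h ∘ g ∘ f = h ∘ k.
Proof. by rewrite -!compA => ->. Qed.

End CatFacts.

Record MonCat := {
  mc_cat :> Category;
  tens : mc_cat -> mc_cat -> mc_cat;
  one : mc_cat;
  tensm : forall X X' Y Y' : mc_cat,
    Hom X X' -> Hom Y Y' -> Hom (tens X Y) (tens X' Y');
  tensm1 : forall X Y, tensm (idm X) (idm Y) = idm (tens X Y);
  tensmM : forall X X' X'' Y Y' Y'' (f' : Hom X' X'') (f : Hom X X')
      (g' : Hom Y' Y'') (g : Hom Y Y'),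
    tensm (f' ∘ f) (g' ∘ g) = tensm f' g' ∘ tensm f g;
  tensA : forall X Y Z, tens (tens X Y) Z = tens X (tens Y Z);
  tens1X : forall X, tens one X = X;
  tensX1 : forall X, tens X one = X;
  tensmA : forall X X' Y Y' Z Z'
      (f : Hom X X') (g : Hom Y Y') (h : Hom Z Z'),
    eqh (tensA X' Y' Z') ∘ tensm (tensm f g) h
    = tensm f (tensm g h) ∘ eqh (tensA X Y Z);
  tens1m : forall X X' (f : Hom X X'),
    eqh (tens1X X') ∘ tensm (idm one) f = f ∘ eqh (tens1X X);
  tensm1r : forall X X' (f : Hom X X'),
    eqh (tensX1 X') ∘ tensm f (idm one) = f ∘ eqh (tensX1 X) }.

Arguments tens {m} _ _.
Arguments tensm {m X X' Y Y'} _ _.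
Arguments one {m}.
Notation "X ⊗ Y" := (tens X Y) (at level 35, right associativity) : cat_scope.
Notation "f ⊗m g" := (tensm f g) (at level 35, right associativity) : cat_scope.
Notation "'𝟏'" := one : cat_scope.

Section Structural.
Context {A : MonCat}.

Definition assoc (X Y Z : A) : Hom ((X ⊗ Y) ⊗ Z) (X ⊗ (Y ⊗ Z)) :=
  eqh (tensA X Y Z).
Definition assoc' (X Y Z : A) : Hom (X ⊗ (Y ⊗ Z)) ((X ⊗ Y) ⊗ Z) :=
  eqh (eq_sym (tensA X Y Z)).
Definition lun (X : A) : Hom (𝟏 ⊗ X) X := eqh (tens1X X).
Definition lun' (X : A) : Hom X (𝟏 ⊗ X) := eqh (eq_sym (tens1X X)).
Definition run (X : A) : Hom (X ⊗ 𝟏) X := eqh (tensX1 X).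
Definition run' (X : A) : Hom X (X ⊗ 𝟏) := eqh (eq_sym (tensX1 X)).

Lemma tensm_eqh (X X' Y Y' : A) (e : X = X') (e' : Y = Y') :
  eqh e ⊗m eqh e' = eqh (f_equal2 tens e e').
Proof. by destruct e, e'; rewrite /= tensm1 eqh_id. Qed.

Lemma tensmMl (X X' X'' Y : A) (f' : Hom X' X'') (f : Hom X X') :
  (f' ∘ f) ⊗m idm Y = (f' ⊗m idm Y) ∘ (f ⊗m idm Y).
Proof. by rewrite -tensmM comp1m. Qed.

Lemma tensmMr (X X' X'' Y : A) (f' : Hom X' X'') (f : Hom X X') :
  idm Y ⊗m (f' ∘ f) = (idm Y ⊗m f') ∘ (idm Y ⊗m f).
Proof. by rewrite -tensmM comp1m. Qed.

End Structural.

Record AutCat := {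
  ac_mon :> MonCat;
  ldual : ac_mon -> ac_mon;
  ev : forall X, Hom (ldual X ⊗ X) 𝟏;
  coev : forall X, Hom 𝟏 (X ⊗ ldual X);
  rdual : ac_mon -> ac_mon;
  rev : forall X, Hom (X ⊗ rdual X) 𝟏;
  rcoev : forall X, Hom 𝟏 (rdual X ⊗ X);
  ldual_zigzag : forall X,
    run X ∘ (idm X ⊗m ev X) ∘ assoc X (ldual X) X ∘ (coev X ⊗m idm X) ∘ lun' X
    = idm X;
  ldual_zagzig : forall X,
    lun _ ∘ (ev X ⊗m idm (ldual X)) ∘ assoc' (ldual X) X (ldual X)
      ∘ (idm (ldual X) ⊗m coev X) ∘ run' _
    = idm (ldual X);
  rdual_zigzag : forall X,
    lun X ∘ (rev X ⊗m idm X) ∘ assoc' X (rdual X) X ∘ (idm X ⊗m rcoev X) ∘ run' X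
    = idm X;
  rdual_zagzig : forall X,
    run _ ∘ (idm (rdual X) ⊗m rev X) ∘ assoc (rdual X) X (rdual X)
      ∘ (rcoev X ⊗m idm (rdual X)) ∘ lun' _
    = idm (rdual X) }.

Arguments ldual {a} X.
Arguments ev {a} X.
Arguments coev {a} X.
Arguments rdual {a} X.
Arguments rev {a} X.
Arguments rcoev {a} X.

Section DualMorphisms.
Context {C : AutCat}.

Definition ldualm (X Y : C) (f : Hom X Y) : Hom (ldual Y) (ldual X) :=
  lun _ ∘ (ev Y ⊗m idm (ldual X)) ∘ assoc' (ldual Y) Y (ldual X)
    ∘ (idm (ldual Y) ⊗m (f ⊗m idm (ldual X))) ∘ (idm (ldual Y) ⊗m coev X) ∘ run' _.

Definition rdualm (X Y : C) (f : Hom X Y) : Hom (rdual Y) (rdual X) :=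
  run _ ∘ (idm (rdual X) ⊗m rev Y) ∘ assoc (rdual X) Y (rdual Y)
    ∘ ((idm (rdual X) ⊗m f) ⊗m idm (rdual Y)) ∘ (rcoev X ⊗m idm (rdual Y)) ∘ lun' _.

End DualMorphisms.

Record ComonoidalOn (A B : MonCat) (F : Functor A B) := {
  cm2 : forall X Y, Hom (F (X ⊗ Y)) (F X ⊗ F Y);
  cm0 : Hom (F 𝟏) 𝟏;
  cm2_nat : forall X X' Y Y' (f : Hom X X') (g : Hom Y Y'),
    (fmap F f ⊗m fmap F g) ∘ cm2 X Y = cm2 X' Y' ∘ fmap F (f ⊗m g);
  cm_coassoc : forall X Y Z,
    assoc _ _ _ ∘ (cm2 X Y ⊗m idm (F Z)) ∘ cm2 (X ⊗ Y) Z
    = (idm (F X) ⊗m cm2 Y Z) ∘ cm2 X (Y ⊗ Z) ∘ fmap F (assoc X Y Z);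
  cm_counitl : forall X, lun _ ∘ (cm0 ⊗m idm (F X)) ∘ cm2 𝟏 X = fmap F (lun X);
  cm_counitr : forall X, run _ ∘ (idm (F X) ⊗m cm0) ∘ cm2 X 𝟏 = fmap F (run X) }.

Record ComonFunctor (A B : MonCat) := {
  cf_fun :> Functor A B;
  cf_on : ComonoidalOn cf_fun }.

Definition id_comon (A : MonCat) : ComonoidalOn (idF A).
Proof.
refine {| cm2 := fun X Y => idm (X ⊗ Y) : Hom (idF A (X ⊗ Y)) (idF A X ⊗ idF A Y);
          cm0 := idm 𝟏 : Hom (idF A 𝟏) 𝟏 |} => /=.
- abstract (by move=> *; rewrite compm1 comp1m).
- abstract (by move=> *; rewrite !tensm1 !comp1m !compm1).
- abstract (by move=> *; rewrite tensm1 !compm1).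
- abstract (by move=> *; rewrite tensm1 !compm1).
Defined.

Definition comp_comon (A B D : MonCat) (G : Functor B D) (F : Functor A B)
  (g : ComonoidalOn G) (f : ComonoidalOn F) : ComonoidalOn (G ∘F F).
Proof.
refine {| cm2 := fun X Y => (cm2 g (F X) (F Y) ∘ fmap G (cm2 f X Y) :
            Hom ((G ∘F F) (X ⊗ Y)) ((G ∘F F) X ⊗ (G ∘F F) Y));
          cm0 := (cm0 g ∘ fmap G (cm0 f) : Hom ((G ∘F F) 𝟏) 𝟏) |} => /=.
- abstract (move=> X X' Y Y' a b;
    by rewrite compA cm2_nat -!compA -!fmapM cm2_nat).
- abstract (move=> X Y Z;
    have e1 := @cm2_nat _ _ _ g _ _ _ _ (cm2 f X Y) (idm (F Z));
    have e2 := @cm2_nat _ _ _ g _ _ _ _ (idm (F X)) (cm2 f Y Z);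
    rewrite fmap1 in e1; rewrite fmap1 in e2;
    rewrite tensmMl tensmMr !compA (compr _ e1) cm_coassoc (compr _ e2);
    by rewrite -!compA -!fmapM !compA cm_coassoc).
- abstract (move=> X;
    have e1 := @cm2_nat _ _ _ g _ _ _ _ (cm0 f) (idm (F X));
    rewrite fmap1 in e1;
    by rewrite tensmMl !compA (compr _ e1) cm_counitl -!fmapM cm_counitl).
- abstract (move=> X;
    have e1 := @cm2_nat _ _ _ g _ _ _ _ (idm (F X)) (cm0 f);
    rewrite fmap1 in e1;
    by rewrite tensmMr !compA (compr _ e1) cm_counitr -!fmapM cm_counitr).
Defined.

Definition comonoidal_nat (A B : MonCat) (F G : Functor A B)
    (f : ComonoidalOn F) (g : ComonoidalOn G) (a : Nat F G) : Prop :=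
  (forall X Y, cm2 g X Y ∘ a (X ⊗ Y) = (a X ⊗m a Y) ∘ cm2 f X Y) /\
  cm0 g ∘ a 𝟏 = cm0 f.

Record MonadOn (C : Category) (F : Functor C C) := {
  mu : Nat (F ∘F F) F;
  eta : Nat (idF C) F;
  mu_assoc : forall X, mu X ∘ fmap F (mu X) = mu X ∘ mu (F X);
  mu_etal : forall X, mu X ∘ eta (F X) = idm (F X);
  mu_etar : forall X, mu X ∘ fmap F (eta X) = idm (F X) }.

Lemma mu_nat (C : Category) (F : Functor C C) (m : MonadOn F) (X Y : C)
    (f : Hom X Y) :
  fmap F f ∘ mu m X = mu m Y ∘ fmap F (fmap F f).
Proof. exact: (nat_nat (mu m)). Qed.

Lemma eta_nat (C : Category) (F : Functor C C) (m : MonadOn F) (X Y : C)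
    (f : Hom X Y) :
  fmap F f ∘ eta m X = eta m Y ∘ f.
Proof. exact: (nat_nat (eta m)). Qed.

Record Monad (C : Category) := {
  mon_fun :> Functor C C;
  mon_on : MonadOn mon_fun }.

Record BimonadOn (A : MonCat) (F : Functor A A) := {
  bo_monad :> MonadOn F;
  bo_comon :> ComonoidalOn F;
  mu_comon : comonoidal_nat (comp_comon bo_comon bo_comon) bo_comon (mu bo_monad);
  eta_comon : comonoidal_nat (id_comon A) bo_comon (eta bo_monad) }.

Section BimonadFacts.
Context {A : MonCat} {F : Functor A A} (b : BimonadOn F).

Lemma mu_cm2 (X Y : A) :
  cm2 b X Y ∘ mu b (X ⊗ Y) = (mu b X ⊗m mu b Y) ∘ cm2 b (F X) (F Y) ∘ fmap F (cm2 b X Y).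
Proof. by rewrite -compA; exact: (proj1 (mu_comon b)). Qed.

Lemma mu_cm0 : cm0 b ∘ mu b 𝟏 = cm0 b ∘ fmap F (cm0 b).
Proof. exact: (proj2 (mu_comon b)). Qed.

Lemma eta_cm2 (X Y : A) : cm2 b X Y ∘ eta b (X ⊗ Y) = eta b X ⊗m eta b Y.
Proof. by rewrite -[RHS]compm1; exact: (proj1 (eta_comon b)). Qed.

Lemma eta_cm0 : cm0 b ∘ eta b 𝟏 = idm 𝟏.
Proof. exact: (proj2 (eta_comon b)). Qed.

End BimonadFacts.

Record Bimonad (A : MonCat) := {
  bi_fun : Functor A A;
  bi_on : BimonadOn bi_fun }.

Coercion bi_monad (A : MonCat) (T : Bimonad A) : Monad A :=
  {| mon_fun := bi_fun T; mon_on := bi_on T |}.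

Definition bi_comon (A : MonCat) (T : Bimonad A) : ComonoidalOn T := bi_on T.

Notation "'μ' T" := (mu (mon_on T)) (at level 10, T at level 9) : cat_scope.
Notation "'η' T" := (eta (mon_on T)) (at level 10, T at level 9) : cat_scope.

Section Antipodes.
Context {C : AutCat} (T : Bimonad C).

Local Notation T2 := (cm2 (bi_comon T)).
Local Notation T0 := (cm0 (bi_comon T)).

Record is_left_antipode (s : forall X : C, Hom (T (ldual (T X))) (ldual X)) : Prop := {
  sl_nat : forall (X Y : C) (f : Hom X Y),
    ldualm f ∘ s Y = s X ∘ fmap T (ldualm (fmap T f));
  sl_ev : forall X : C,
    T0 ∘ fmap T (ev X) ∘ fmap T (ldualm (η T X) ⊗m idm X)
    = ev (T X) ∘ ((s (T X) ∘ fmap T (ldualm (μ T X))) ⊗m idm (T X))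
        ∘ T2 (ldual (T X)) X;
  sl_coev : forall X : C,
    (η T X ⊗m idm (ldual X)) ∘ coev X ∘ T0
    = (μ T X ⊗m s X) ∘ T2 (T X) (ldual (T X)) ∘ fmap T (coev (T X)) }.

Record is_right_antipode (s : forall X : C, Hom (T (rdual (T X))) (rdual X)) : Prop := {
  sr_nat : forall (X Y : C) (f : Hom X Y),
    rdualm f ∘ s Y = s X ∘ fmap T (rdualm (fmap T f));
  sr_ev : forall X : C,
    T0 ∘ fmap T (rev X) ∘ fmap T (idm X ⊗m rdualm (η T X))
    = rev (T X) ∘ (idm (T X) ⊗m (s (T X) ∘ fmap T (rdualm (μ T X))))
        ∘ T2 X (rdual (T X));
  sr_coev : forall X : C,
    (idm (rdual X) ⊗m η T X) ∘ rcoev X ∘ T0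
    = (s X ⊗m μ T X) ∘ T2 (rdual (T X)) (T X) ∘ fmap T (rcoev (T X)) }.

End Antipodes.

Record HopfMonad (C : AutCat) := {
  hopf_bimonad :> Bimonad C;
  hopf_left : exists s, is_left_antipode (T := hopf_bimonad) s;
  hopf_right : exists s, is_right_antipode (T := hopf_bimonad) s }.

Section Modules.
Context {C : Category} (T : Monad C).

Record Module := {
  car : C;
  act : Hom (T car) car;
  act_mu : act ∘ fmap T act = act ∘ μ T car;
  act_eta : act ∘ η T car = idm car }.

Record LinHom (M N : Module) := {
  lin :> Hom (car M) (car N);
  lin_act : lin ∘ act M = act N ∘ fmap T lin }.

Lemma lin_eq (M N : Module) (f g : LinHom M N) : lin f = lin g -> f = g.
Proof.
case: f g => f hf [g hg] /= e; subst g.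
by rewrite (proof_irrelevance _ hf hg).
Qed.

Lemma lin_act_id (M : Module) : idm (car M) ∘ act M = act M ∘ fmap T (idm (car M)).
Proof. by rewrite fmap1 comp1m compm1. Qed.

Lemma lin_act_comp (M N P : Module) (g : LinHom N P) (f : LinHom M N) :
  (g ∘ f) ∘ act M = act P ∘ fmap T (g ∘ f).
Proof. by rewrite fmapM compA -lin_act -!compA lin_act. Qed.

Definition ModCat : Category.
Proof.
refine {| Ob := Module; Hom := LinHom;
  idm := fun M => {| lin := idm (car M); lin_act := lin_act_id M |};
  comp := fun M N P g f => {| lin := lin g ∘ lin f; lin_act := lin_act_comp g f |} |}.
- abstract (by move=> *; apply: lin_eq; rewrite /= compA).
- abstract (by move=> *; apply: lin_eq; rewrite /= comp1m).
- abstract (by move=> *; apply: lin_eq; rewrite /= compm1).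
Defined.

Definition forgetF : Functor ModCat C :=
  {| fobj := (fun M => car M) : ModCat -> C;
     fmap := fun M N (f : @Hom ModCat M N) => lin f;
     fmap1 := fun _ => eq_refl; fmapM := fun _ _ _ _ _ => eq_refl |}.

Definition free_mod (X : C) : Module :=
  {| car := T X; act := μ T X; act_mu := mu_assoc _ X; act_eta := mu_etal _ X |}.

Definition free_lin (X Y : C) (f : Hom X Y) : LinHom (free_mod X) (free_mod Y) :=
  {| lin := fmap T f : Hom (car (free_mod X)) (car (free_mod Y));
     lin_act := nat_nat (μ T) f |}.

Definition freeF : Functor C ModCat.
Proof.
unshelve refine {| fobj := free_mod : C -> ModCat; fmap := free_lin |}.
- abstract (by move=> X; apply: lin_eq; rewrite /= fmap1).
- abstract (by move=> *; apply: lin_eq; rewrite /= fmapM).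
Defined.

(** The action of a module, as a morphism of modules [F_T(M) -> (M, r)]; this
    is the counit of the adjunction between [freeF] and [forgetF]. *)
Definition counit (M : ModCat) : @Hom ModCat (freeF (forgetF M)) M :=
  {| lin := act M : Hom (car (free_mod (car M))) (car M);
     lin_act := eq_sym (act_mu M) |}.

Lemma counit_nat (M N : ModCat) (f : Hom M N) :
  f ∘ counit M = counit N ∘ fmap freeF (fmap forgetF f).
Proof. by apply: lin_eq; rewrite /= lin_act. Qed.

Lemma mod_eq (M N : Module) (e : car M = car N) :
  eqh e ∘ act M = act N ∘ fmap T (eqh e) -> M = N.
Proof.
case: M N e => M r r1 r2 [N s s1 s2] /= e; subst N.
rewrite /= fmap1 comp1m compm1 => e; subst s.
by rewrite (proof_irrelevance _ r1 s1) (proof_irrelevance _ r2 s2).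
Qed.

Lemma lin_eqh (M N : ModCat) (e : M = N) (e' : car M = car N) :
  lin (eqh e) = eqh e'.
Proof. by destruct e; rewrite [RHS]eqh_id. Qed.

End Modules.

Arguments forgetF {C} T.
Arguments freeF {C} T.
Arguments counit {C T} M.
Arguments lin {C T M N} _.
Arguments lin_eq {C T M N f g} _.

Section ModulesMon.
Context {C : MonCat} (T : Bimonad C).

Local Notation T2 := (cm2 (bi_comon T)).
Local Notation T0 := (cm0 (bi_comon T)).

Lemma tens_act_mu (M N : ModCat T) (r := (act M ⊗m act N) ∘ T2 (car M) (car N)) :
  r ∘ fmap T r = r ∘ μ T (car M ⊗ car N).
Proof.
rewrite /r fmapM compA (compr _ (eq_sym (cm2_nat _ _ _))) -tensmM.
rewrite -[RHS]compA [T2 _ _ ∘ _](mu_cm2 (bi_on T)) !compA.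
by rewrite -tensmM !act_mu.
Qed.

Lemma tens_act_eta (M N : ModCat T) :
  (act M ⊗m act N) ∘ T2 (car M) (car N) ∘ η T (car M ⊗ car N) = idm (car M ⊗ car N).
Proof.
by rewrite -compA [T2 _ _ ∘ _](eta_cm2 (bi_on T)) -tensmM !act_eta tensm1.
Qed.

Definition tens_mod (M N : ModCat T) : ModCat T :=
  {| car := car M ⊗ car N; act := (act M ⊗m act N) ∘ T2 (car M) (car N);
     act_mu := tens_act_mu M N; act_eta := tens_act_eta M N |}.

Definition one_mod : ModCat T :=
  {| car := 𝟏; act := T0; act_mu := eq_sym (mu_cm0 (bi_on T));
     act_eta := eta_cm0 (bi_on T) |}.

Lemma tens_lin_act (M M' N N' : ModCat T) (f : Hom M M') (g : Hom N N') :
  (lin f ⊗m lin g) ∘ act (tens_mod M N) = act (tens_mod M' N') ∘ fmap T (lin f ⊗m lin g).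
Proof. by rewrite /= compA -tensmM !lin_act tensmM -!compA cm2_nat. Qed.

Definition tens_lin (M M' N N' : ModCat T) (f : Hom M M') (g : Hom N N') :
    Hom (tens_mod M N) (tens_mod M' N') :=
  {| lin := lin f ⊗m lin g : Hom (car (tens_mod M N)) (car (tens_mod M' N'));
     lin_act := tens_lin_act f g |}.

Lemma tens_modA (M N P : ModCat T) :
  tens_mod (tens_mod M N) P = tens_mod M (tens_mod N P).
Proof.
apply: (@mod_eq _ _ (tens_mod (tens_mod M N) P) (tens_mod M (tens_mod N P))
          (tensA _ _ _)).
rewrite /=.
have -> : ((act M ⊗m act N) ∘ T2 (car M) (car N)) ⊗m act P
  = ((act M ⊗m act N) ⊗m act P) ∘ (T2 (car M) (car N) ⊗m idm _).
  by rewrite -tensmM compm1.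
have -> : act M ⊗m ((act N ⊗m act P) ∘ T2 (car N) (car P))
  = (act M ⊗m (act N ⊗m act P)) ∘ (idm _ ⊗m T2 (car N) (car P)).
  by rewrite -tensmM compm1.
rewrite !compA tensmA -!compA; congr (_ ∘ _).
by rewrite !compA; exact: cm_coassoc.
Qed.

Lemma tens_mod1X (M : ModCat T) : tens_mod one_mod M = M.
Proof.
apply: (@mod_eq _ _ (tens_mod one_mod M) M (tens1X _)) => /=.
have -> : T0 ⊗m act M = (idm 𝟏 ⊗m act M) ∘ (T0 ⊗m idm _).
  by rewrite -tensmM comp1m compm1.
rewrite !compA tens1m -!compA; congr (_ ∘ _).
by rewrite !compA; exact: cm_counitl.
Qed.

Lemma tens_modX1 (M : ModCat T) : tens_mod M one_mod = M.
Proof.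
apply: (@mod_eq _ _ (tens_mod M one_mod) M (tensX1 _)) => /=.
have -> : act M ⊗m T0 = (act M ⊗m idm 𝟏) ∘ (idm _ ⊗m T0).
  by rewrite -tensmM comp1m compm1.
rewrite !compA tensm1r -!compA; congr (_ ∘ _).
by rewrite !compA; exact: cm_counitr.
Qed.

Definition ModMon : MonCat.
Proof.
refine {| mc_cat := ModCat T; tens := tens_mod; one := one_mod;
  tensm := tens_lin; tensA := tens_modA; tens1X := tens_mod1X;
  tensX1 := tens_modX1 |}.
- abstract (by move=> X Y; apply: lin_eq; rewrite /= tensm1).
- abstract (by move=> *; apply: lin_eq; rewrite /= tensmM).
- abstract (move=> X X' Y Y' Z Z' f g h; apply: lin_eq => /=;
  by rewrite (lin_eqh (tens_modA X' Y' Z') (tensA _ _ _))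
    (lin_eqh (tens_modA X Y Z) (tensA _ _ _)) tensmA).
- abstract (move=> X X' f; apply: lin_eq => /=;
  by rewrite (lin_eqh (tens_mod1X X') (tens1X _)) (lin_eqh (tens_mod1X X) (tens1X _))
    tens1m).
- abstract (move=> X X' f; apply: lin_eq => /=;
  by rewrite (lin_eqh (tens_modX1 X') (tensX1 _)) (lin_eqh (tens_modX1 X) (tensX1 _))
    tensm1r).
Defined.

Definition forgetM : Functor ModMon C := forgetF T.
Definition freeM : Functor C ModMon := freeF T.
Definition counitM (M : ModMon) : Hom (freeM (forgetM M)) M := counit M.

Lemma lin_assoc (M N P : ModMon) : lin (assoc M N P) = assoc (car M) (car N) (car P).
Proof. exact: (@lin_eqh _ _ (tens_mod _ _) (tens_mod _ _)). Qed.

Lemma lin_lun (M : ModMon) : lin (lun M) = lun (car M).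
Proof. exact: (@lin_eqh _ _ (tens_mod _ _) _). Qed.

Lemma lin_run (M : ModMon) : lin (run M) = run (car M).
Proof. exact: (@lin_eqh _ _ (tens_mod _ _) _). Qed.

(** [U_T] is strict monoidal. *)
Definition forget_comon : ComonoidalOn forgetM.
Proof.
unshelve refine (@Build_ComonoidalOn ModMon C forgetM
  (fun M N => idm (car M ⊗ car N)) (idm 𝟏) _ _ _ _) => /=.
- abstract (by move=> *; rewrite compm1 comp1m).
- abstract (move=> M N P;
    apply: (eq_trans (cm_coassoc (id_comon C) (car M) (car N) (car P)));
    by congr (_ ∘ _); exact: (eq_sym (lin_assoc M N P))).
- abstract (move=> M; rewrite lin_lun; exact: (cm_counitl (id_comon C))).
- abstract (move=> M; rewrite lin_run; exact: (cm_counitr (id_comon C))).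
Defined.

End ModulesMon.

Arguments forgetM {C} T.
Arguments freeM {C} T.
Arguments counitM {C T} M.

Definition cross (C : Category) (T : Monad C)
    (Q : Functor (ModCat T) (ModCat T)) : Functor C C :=
  forgetF T ∘F Q ∘F freeF T.

Section CrossMonad.
Context {C : Category} {T : Monad C} {Q : Functor (ModCat T) (ModCat T)}.
Variable q : MonadOn Q.

Local Notation F := (freeF T).
Local Notation U := (forgetF T).

Definition cross_mul (X : C) : Hom (Q (F (U (Q (F X))))) (Q (F X)) :=
  mu q (F X) ∘ fmap Q (counit (Q (F X))).

Lemma cross_mul_nat (X Y : C) (f : Hom X Y) :
  fmap Q (fmap F f) ∘ cross_mul X
  = cross_mul Y ∘ fmap Q (fmap F (fmap U (fmap Q (fmap F f)))).
Proof.
rewrite /cross_mul compA mu_nat.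
by rewrite -[LHS]compA -[RHS]compA -!fmapM counit_nat.
Qed.

Lemma cross_mul_assoc (X : C) :
  cross_mul X ∘ fmap Q (fmap F (fmap U (cross_mul X))) = cross_mul X ∘ cross_mul (U (Q (F X))).
Proof.
rewrite /cross_mul -[LHS]compA -fmapM -counit_nat !fmapM !compA.
rewrite (mu_assoc q); congr (_ ∘ _).
by rewrite (compr _ (mu_nat q _)).
Qed.

Definition cross_mu : Nat (cross Q ∘F cross Q) (cross Q) :=
  {| nat_at := fun X => lin (cross_mul X) : Hom ((cross Q ∘F cross Q) X) (cross Q X);
     nat_nat := fun X Y f => f_equal lin (cross_mul_nat f) |}.

Lemma cross_eta_nat (X Y : C) (f : Hom X Y) :
  lin (fmap Q (fmap F f)) ∘ (lin (eta q (F X)) ∘ η T X)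
  = lin (eta q (F Y)) ∘ η T Y ∘ f.
Proof.
have e := f_equal lin (eta_nat q (fmap F f)); rewrite /= in e.
by rewrite compA e -!compA; congr (_ ∘ _); exact: (eta_nat (mon_on T)).
Qed.

Definition cross_eta : Nat (idF C) (cross Q) :=
  {| nat_at := fun X => lin (eta q (F X)) ∘ η T X : Hom (idF C X) (cross Q X);
     nat_nat := cross_eta_nat |}.

Lemma cross_assoc (X : C) :
  cross_mu X ∘ fmap (cross Q) (cross_mu X) = cross_mu X ∘ cross_mu (cross Q X).
Proof. exact: (f_equal lin (cross_mul_assoc X)). Qed.

Lemma cross_etal (X : C) : cross_mu X ∘ cross_eta (cross Q X) = idm (cross Q X).
Proof.
have e := f_equal lin (eta_nat q (counit (Q (F X)))); rewrite /= in e.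
have e' := f_equal lin (mu_etal q (F X)); rewrite /= in e'.
by rewrite /= compA (compr _ e) e' comp1m act_eta.
Qed.

Lemma cross_etar (X : C) :
  cross_mu X ∘ fmap (cross Q) (cross_eta X) = idm (cross Q X).
Proof.
have e : counit (Q (F X)) ∘ fmap F (lin (eta q (F X)) ∘ η T X) = eta q (F X).
  apply: lin_eq; rewrite /= fmapM compA -(lin_act (eta q (F X))) -compA /=.
  by rewrite (mu_etar (mon_on T)) compm1.
have e' := mu_etar q (F X).
by rewrite -e (fmapM Q) compA in e'; exact: (f_equal lin e').
Qed.

Definition cross_monad : MonadOn (cross Q) :=
  {| mu := cross_mu; eta := cross_eta; mu_assoc := cross_assoc;
     mu_etal := cross_etal; mu_etar := cross_etar |}.

End CrossMonad.

Section CrossBimonad.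
Context {C : MonCat} {T : Bimonad C} {Q : Functor (ModMon T) (ModMon T)}.

Local Notation F := (freeM T).
Local Notation U := (forgetM T).

Definition free_cm2 (X Y : C) : Hom (F (X ⊗ Y)) (F X ⊗ F Y) :=
  counitM (F X ⊗ F Y) ∘ fmap F (η T X ⊗m η T Y).

Definition free_cm0 : Hom (F 𝟏) 𝟏 := counitM 𝟏.

Lemma lin_free_cm2 (X Y : C) : lin (free_cm2 X Y) = cm2 (bi_comon T) X Y.
Proof.
have e := @cm2_nat _ _ _ (bi_comon T) _ _ _ _ (η T X) (η T Y).
rewrite /= in e.
change ((μ T X ⊗m μ T Y) ∘ cm2 (bi_comon T) (T X) (T Y) ∘ fmap T (η T X ⊗m η T Y)
  = cm2 (bi_comon T) X Y).
rewrite -compA -e compA -tensmM.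
by rewrite !(mu_etar (mon_on T)) tensm1 comp1m.
Qed.

Definition free_comon : ComonoidalOn F.
Proof.
refine {| cm2 := free_cm2; cm0 := free_cm0 |}.
- abstract (move=> X X' Y Y' f g; apply: lin_eq; rewrite [LHS]/= [RHS]/=;
    have e V W := lin_free_cm2 V W; rewrite /= in e; rewrite !e; exact: cm2_nat).
- abstract (move=> X Y Z; apply: lin_eq; rewrite [LHS]/= [RHS]/= lin_assoc;
    have e V W := lin_free_cm2 V W; rewrite /= in e; rewrite !e; exact: cm_coassoc).
- abstract (move=> X; apply: lin_eq; rewrite [LHS]/= [RHS]/= lin_lun;
    have e V W := lin_free_cm2 V W; rewrite /= in e; rewrite !e;
    exact: (cm_counitl (bi_comon T))).
- abstract (move=> X; apply: lin_eq; rewrite [LHS]/= [RHS]/= lin_run;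
    have e V W := lin_free_cm2 V W; rewrite /= in e; rewrite !e;
    exact: (cm_counitr (bi_comon T))).
Defined.

Lemma counit_tens (M N : ModMon T) :
  (counitM M ⊗m counitM N) ∘ free_cm2 (U M) (U N) = counitM (M ⊗ N).
Proof.
by apply: lin_eq; have := lin_free_cm2 (U M) (U N); rewrite /= => ->.
Qed.

Definition cross_comon (q : ComonoidalOn Q) : ComonoidalOn (cross Q).
Proof.
unshelve refine (@Build_ComonoidalOn C C (cross Q)
  (fun X Y => lin (cm2 q (F X) (F Y) ∘
      fmap Q (counitM (F X ⊗ F Y) ∘ fmap F (η T X ⊗m η T Y))))
  (lin (cm0 q ∘ fmap Q (counitM 𝟏))) _ _ _ _).
- abstract (move=> X X' Y Y' f g;
    exact: (f_equal lin (cm2_nat (comp_comon q free_comon) f g))).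
- abstract (move=> X Y Z;
    have := f_equal lin (cm_coassoc (comp_comon q free_comon) X Y Z);
    by rewrite [lin _]/= [RHS]/= lin_assoc).
- abstract (move=> X; have := f_equal lin (cm_counitl (comp_comon q free_comon) X);
    by rewrite [lin _]/= [RHS]/= lin_lun).
- abstract (move=> X; have := f_equal lin (cm_counitr (comp_comon q free_comon) X);
    by rewrite [lin _]/= [RHS]/= lin_run).
Defined.

Section CrossOfBimonads.
Variable q : BimonadOn Q.

Let qM (X : C) : Hom (Q (F (U (Q (F X))))) (Q (F X)) :=
  mu q (F X) ∘ fmap Q (counitM (Q (F X))).
Let c2 (X Y : C) : Hom (Q (F (X ⊗ Y))) (Q (F X) ⊗ Q (F Y)) :=
  cm2 q (F X) (F Y) ∘ fmap Q (free_cm2 X Y).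
Let c0 : Hom (Q (F 𝟏)) 𝟏 := cm0 q ∘ fmap Q (counitM 𝟏).

Lemma counitM_nat (M N : ModMon T) (f : Hom M N) :
  f ∘ counitM M = counitM N ∘ fmap F (fmap U f).
Proof. exact: counit_nat. Qed.

Lemma cross_mul_comon (X Y : C) :
  c2 X Y ∘ qM (X ⊗ Y)
  = (qM X ⊗m qM Y) ∘ (c2 (U (Q (F X))) (U (Q (F Y))) ∘ fmap Q (fmap F (fmap U (c2 X Y)))).
Proof.
rewrite /qM /c2 compA (compr _ (mu_nat q _)) mu_cm2 tensmM.
rewrite !compA (compr _ (cm2_nat q _ _)).
rewrite -!compA; congr (_ ∘ (_ ∘ _)).
rewrite -!fmapM; congr (fmap Q _).
by rewrite [RHS]compA (counit_tens (Q (F X)) (Q (F Y))) compA -(counitM_nat (c2 X Y)).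
Qed.

Lemma cross_mul_comon0 :
  c0 ∘ qM 𝟏 = c0 ∘ fmap Q (fmap F (fmap U c0)).
Proof.
rewrite /c0 /qM compA (compr _ (mu_nat q _)) mu_cm0.
by rewrite -!compA -!fmapM -(counitM_nat c0) -compA.
Qed.

Lemma cross_mu_comon :
  comonoidal_nat (comp_comon (cross_comon q) (cross_comon q)) (cross_comon q)
    (mu (cross_monad q)).
Proof.
split=> [X Y|]; first exact: (f_equal lin (cross_mul_comon X Y)).
exact: (f_equal lin cross_mul_comon0).
Qed.

Lemma cross_eta_comon :
  comonoidal_nat (id_comon C) (cross_comon q) (eta (cross_monad q)).
Proof.
split=> [X Y|].
- have e : c2 X Y ∘ eta q (F (X ⊗ Y)) = (eta q (F X) ⊗m eta q (F Y)) ∘ free_cm2 X Y.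
    rewrite /c2 -compA eta_nat compA; congr (_ ∘ _).
    exact: eta_cm2.
  have e1 := f_equal lin e.
  change (lin (c2 X Y) ∘ (lin (eta q (F (X ⊗ Y))) ∘ η T (X ⊗ Y))
    = (lin (eta q (F X)) ∘ η T X) ⊗m (lin (eta q (F Y)) ∘ η T Y) ∘ idm (X ⊗ Y)).
  rewrite compm1 tensmM compA [lin _ ∘ lin _]e1.
  change (lin (eta q (F X)) ⊗m lin (eta q (F Y)) ∘ lin (free_cm2 X Y) ∘ η T (X ⊗ Y)
    = lin (eta q (F X)) ⊗m lin (eta q (F Y)) ∘ (η T X ⊗m η T Y)).
  rewrite -compA; congr (_ ∘ _); rewrite [lin _]lin_free_cm2.
  exact: (eta_cm2 (bi_on T)).
- have e : c0 ∘ eta q (F 𝟏) = counitM 𝟏.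
    by rewrite /c0 -compA eta_nat compA eta_cm0 comp1m.
  have e1 := f_equal lin e.
  change (lin c0 ∘ (lin (eta q (F 𝟏)) ∘ η T 𝟏) = idm 𝟏).
  rewrite compA [lin _ ∘ lin _]e1; exact: (eta_cm0 (bi_on T)).
Qed.

Definition cross_bimonad : BimonadOn (cross Q) :=
  {| bo_monad := cross_monad q; bo_comon := cross_comon q;
     mu_comon := cross_mu_comon; eta_comon := cross_eta_comon |}.

End CrossOfBimonads.

End CrossBimonad.

Record Centralizer (A : MonCat) (P : Functor A A) := {
  cz :> Functor A A;
  cz_map : forall X Y : A, Hom (X ⊗ Y) (P Y ⊗ cz X);
  cz_nat : forall (X X' Y Y' : A) (f : Hom X X') (g : Hom Y Y'),
    (fmap P g ⊗m fmap cz f) ∘ cz_map X Y = cz_map X' Y' ∘ (f ⊗m g);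
  cz_univ : forall (X W : A) (xi : forall Y : A, Hom (X ⊗ Y) (P Y ⊗ W)),
    (forall (Y Y' : A) (g : Hom Y Y'),
       (fmap P g ⊗m idm W) ∘ xi Y = xi Y' ∘ (idm X ⊗m g)) ->
    exists! r : Hom (cz X) W, forall Y, xi Y = (idm (P Y) ⊗m r) ∘ cz_map X Y }.

Section CentralizerStructures.
Context {A : MonCat} {P : Functor A A} (Z : Centralizer P).

Local Notation d := (cz_map Z).

(** The equations that determine the monad structure of [Z_P], for [P]
    comonoidal. *)
Definition is_centralizer_monad (p : ComonoidalOn P) (m : MonadOn Z) : Prop :=
  (forall X Y1 Y2 : A,
     (idm (P Y1) ⊗m (idm (P Y2) ⊗m mu m X)) ∘ (idm (P Y1) ⊗m d (Z X) Y2)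
       ∘ assoc (P Y1) (Z X) Y2 ∘ (d X Y1 ⊗m idm Y2)
     = assoc (P Y1) (P Y2) (Z X) ∘ (cm2 p Y1 Y2 ⊗m idm (Z X))
         ∘ d X (Y1 ⊗ Y2) ∘ assoc X Y1 Y2) /\
  (forall X : A,
     eta m X = lun (Z X) ∘ (cm0 p ⊗m idm (Z X)) ∘ d X 𝟏 ∘ run' X).

(** The equations that determine the comonoidal structure of [Z_P], for [P]
    a bimonad. *)
Definition is_centralizer_comon (p : MonadOn P) (c : ComonoidalOn Z) : Prop :=
  (forall X1 X2 Y : A,
     (idm (P Y) ⊗m cm2 c X1 X2) ∘ d (X1 ⊗ X2) Y
     = (mu p Y ⊗m idm (Z X1 ⊗ Z X2)) ∘ assoc (P (P Y)) (Z X1) (Z X2)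
         ∘ (d X1 (P Y) ⊗m idm (Z X2)) ∘ assoc' X1 (P Y) (Z X2)
         ∘ (idm X1 ⊗m d X2 Y) ∘ assoc X1 X2 Y) /\
  (forall Y : A,
     run (P Y) ∘ (idm (P Y) ⊗m cm0 c) ∘ d 𝟏 Y ∘ lun' Y = eta p Y).

Definition is_centralizer_bimonad (p : BimonadOn P) (b : BimonadOn Z) : Prop :=
  is_centralizer_monad p b /\ is_centralizer_comon p b.

End CentralizerStructures.

Arguments is_centralizer_monad {A P} Z p m.
Arguments is_centralizer_comon {A P} Z p c.
Arguments is_centralizer_bimonad {A P} Z p b.

Definition is_monad_lift (C : Category) (T : Monad C)
    (P : Functor C C) (p : MonadOn P)
    (P' : Functor (ModCat T) (ModCat T)) (p' : MonadOn P') : Prop :=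
  exists e : P ∘F forgetF T = forgetF T ∘F P',
    (forall M : ModCat T,
       eqF e M ∘ mu p (car M) = lin (mu p' M) ∘ eqF e (P' M) ∘ fmap P (eqF e M)) /\
    (forall M : ModCat T, eqF e M ∘ eta p (car M) = lin (eta p' M)).

Definition is_bimonad_lift (C : MonCat) (T : Bimonad C)
    (P : Functor C C) (p : BimonadOn P)
    (P' : Functor (ModMon T) (ModMon T)) (p' : BimonadOn P') : Prop :=
  is_monad_lift p p' /\
  {| cf_on := comp_comon (forget_comon T) p' |}
  = {| cf_on := comp_comon p (forget_comon T) |} :> ComonFunctor (ModMon T) C.

Definition is_centralizer_lift (C : MonCat) (T : Bimonad C)
    (Q : Functor (ModMon T) (ModMon T)) (Z : Centralizer (cross Q))
    (ZQ : Centralizer Q) : Prop :=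
  exists e : forgetM T ∘F ZQ = Z ∘F forgetM T,
    forall M N : ModMon T,
      (idm (car (Q N)) ⊗m eqF e M) ∘ lin (cz_map ZQ M N)
      = (lin (fmap Q (counitM N)) ⊗m idm (Z (car M))) ∘ cz_map Z (car M) (car N).

(* Main.v *)
(** Write [F ⊣ U] for the free and forgetful functors of [T]-modules.  The Hopf
    structure gives duals of [T]-modules, hence a right adjoint [K] of [U] with
    counit [e : K W → W], such that for every module [N] the morphism
    [N ⊗ e : N ⊗ K W → N ⊗ W] is again universal among maps from modules.

    For a module [M], the map [∂~_{M,N} : M ⊗ N → Q N ⊗ Z M] therefore lifts to a
    linear [h_N : M ⊗ N → Q N ⊗ K (Z M)].  The family [h_{F Y} (M ⊗ η_Y)] factors
    through [∂_{M,Y}] by a coaction [κ : Z M → K (Z M)], and [e ∘ act ∘ T κ] is the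
    action on [Z M].  Every other property, including uniqueness, follows by
    comparing linear maps after [e] and maps out of [Z M] after [∂].

    The (bi)monad structures are built from universal properties in any monoidal
    category with left duals: there [∂_{X,Y} ⊗ V] is universal for all [V].  To
    avoid associativity isomorphisms, equations between diagrams are tensored on
    the right with a variable object [V] and everything is bracketed to the
    right.  That the lifted structures agree with those of [Z_{Q ⋊ T}] follows from
    [∂~_{M,F Y} (M ⊗ η_Y) = ∂_{M,Y}]. *)

Require Import Defs.
From Corelib Require Import ssreflect.
From Stdlib Require Import ProofIrrelevance FunctionalExtensionality.
From Stdlib Require Import IndefiniteDescription.
Local Open Scope cat_scope.

Set Implicit Arguments.
Unset Strict Implicit.
Unset Printing Implicit Defensive.

Local Notation "f ▷ V" := (tensm f (idm V)) (at level 33, no associativity) : cat_scope.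
Local Notation "V ◁ f" := (tensm (idm V) f) (at level 33, no associativity) : cat_scope.

Lemma seal_sig {T : Type} (x : T) : {y | y = x}.
Proof. by exists x. Qed.

(* An opaque copy of [x], which [rewrite] cannot unfold. *)
Definition seal {T : Type} (x : T) : T := proj1_sig (seal_sig x).

Lemma sealE {T : Type} (x : T) : seal x = x.
Proof. exact: proj2_sig (seal_sig x). Qed.

Lemma post2 {C : Category} {X Y Z : C} {g : Hom Y Z} {f : Hom X Y} {k} :
  g ∘ f = k -> forall W (h : Hom Z W), h ∘ g ∘ f = h ∘ k.
Proof. by move=> e W h; rewrite -compA e. Qed.

Lemma post3 {C : Category} {X Y Z Z' : C} {a : Hom Z Z'} {g : Hom Y Z} {f : Hom X Y} {k} :
  a ∘ g ∘ f = k -> forall W (h : Hom Z' W), h ∘ a ∘ g ∘ f = h ∘ k.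
Proof. by move=> <- W h; rewrite !compA. Qed.

Lemma post4 {C : Category} {X Y Z Z' Z'' : C} {b : Hom Z' Z''} {a : Hom Z Z'}
    {g : Hom Y Z} {f : Hom X Y} {k} :
  b ∘ a ∘ g ∘ f = k -> forall W (h : Hom Z'' W), h ∘ b ∘ a ∘ g ∘ f = h ∘ k.
Proof. by move=> <- W h; rewrite !compA. Qed.

(* Rewrites with an equation between composites, wherever its left-hand side
   occurs as a segment of a left-nested composite. *)
Ltac crw e :=
  first [ rewrite [LHS](post2 e) | rewrite (post2 e) | rewrite (post3 e)
        | rewrite (post4 e) | rewrite e ]; rewrite ?compA ?comp1m ?compm1.

(** * Whiskering and the structural identities of a strict monoidal category *)

Section Structural.
Context {A : MonCat}.

Lemma eqh_rw (X X' Y : A) (e : X = X') :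
  eqh e ▷ Y = eqh (f_equal (fun Z => Z ⊗ Y) e).
Proof. by destruct e; exact: tensm1. Qed.

Lemma eqh_lw (X Y Y' : A) (e : Y = Y') :
  X ◁ eqh e = eqh (f_equal (fun Z => X ⊗ Z) e).
Proof. by destruct e; exact: tensm1. Qed.

Lemma tensm_swap (X X' Y Y' : A) (f : Hom X X') (g : Hom Y Y') :
  (f ▷ Y') ∘ (X ◁ g) = (X' ◁ g) ∘ (f ▷ Y).
Proof. by rewrite -!tensmM !comp1m !compm1. Qed.

Lemma tensm_lr (X X' Y Y' : A) (f : Hom X X') (g : Hom Y Y') :
  (f ▷ Y') ∘ (X ◁ g) = f ⊗m g.
Proof. by rewrite -!tensmM !comp1m !compm1. Qed.

Lemma tensm_rl (X X' Y Y' : A) (f : Hom X X') (g : Hom Y Y') :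
  (X' ◁ g) ∘ (f ▷ Y) = f ⊗m g.
Proof. by rewrite -!tensmM !comp1m !compm1. Qed.

Lemma assocK (X Y Z : A) : assoc X Y Z ∘ assoc' X Y Z = idm _.
Proof. exact: eqhK. Qed.

Lemma assoc'K (X Y Z : A) : assoc' X Y Z ∘ assoc X Y Z = idm _.
Proof. exact: eqhK. Qed.

Lemma lunK (X : A) : lun X ∘ lun' X = idm _.
Proof. exact: eqhK. Qed.

Lemma lun'K (X : A) : lun' X ∘ lun X = idm _.
Proof. exact: eqhK. Qed.

Lemma runK (X : A) : run X ∘ run' X = idm _.
Proof. exact: eqhK. Qed.

Lemma run'K (X : A) : run' X ∘ run X = idm _.
Proof. exact: eqhK. Qed.

Lemma assoc_nat (X X' Y Y' Z Z' : A) (f : Hom X X') (g : Hom Y Y') (h : Hom Z Z') :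
  assoc X' Y' Z' ∘ ((f ⊗m g) ⊗m h) = (f ⊗m (g ⊗m h)) ∘ assoc X Y Z.
Proof. exact: tensmA. Qed.

Lemma assoc'_nat (X X' Y Y' Z Z' : A) (f : Hom X X') (g : Hom Y Y') (h : Hom Z Z') :
  assoc' X' Y' Z' ∘ (f ⊗m (g ⊗m h)) = ((f ⊗m g) ⊗m h) ∘ assoc' X Y Z.
Proof.
have e := @assoc_nat _ _ _ _ _ _ f g h.
rewrite -[LHS]compm1 -(assocK X Y Z) compA -(compA _ _ (assoc _ _ _)) -e.
by rewrite !compA assoc'K comp1m.
Qed.

Lemma lun_nat (X Y : A) (f : Hom X Y) : lun Y ∘ (𝟏 ◁ f) = f ∘ lun X.
Proof. exact: tens1m. Qed.

Lemma run_nat (X Y : A) (f : Hom X Y) : run Y ∘ (f ▷ 𝟏) = f ∘ run X.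
Proof. exact: tensm1r. Qed.

Lemma lun'_nat (X Y : A) (f : Hom X Y) : lun' Y ∘ f = (𝟏 ◁ f) ∘ lun' X.
Proof. by rewrite -[LHS]compm1 -(lunK X) !compA -(compA _ f) -lun_nat compA lun'K comp1m. Qed.

Lemma run'_nat (X Y : A) (f : Hom X Y) : run' Y ∘ f = (f ▷ 𝟏) ∘ run' X.
Proof. by rewrite -[LHS]compm1 -(runK X) !compA -(compA _ f) -run_nat compA run'K comp1m. Qed.

Lemma lw_tens (X Y Z Z' : A) (f : Hom Z Z') :
  (X ⊗ Y) ◁ f = assoc' X Y Z' ∘ (X ◁ (Y ◁ f)) ∘ assoc X Y Z.
Proof. by rewrite assoc'_nat -compA assoc'K compm1 tensm1. Qed.

Lemma rw_tens (X X' Y Z : A) (f : Hom X X') :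
  f ▷ (Y ⊗ Z) = assoc X' Y Z ∘ ((f ▷ Y) ▷ Z) ∘ assoc' X Y Z.
Proof. by rewrite assoc_nat -compA assocK compm1 tensm1. Qed.

Lemma rw_lw (X Y Y' Z : A) (f : Hom Y Y') :
  (X ◁ f) ▷ Z = assoc' X Y' Z ∘ (X ◁ (f ▷ Z)) ∘ assoc X Y Z.
Proof. by rewrite assoc'_nat -compA assoc'K compm1. Qed.

Lemma lw_one (X Y : A) (f : Hom X Y) : 𝟏 ◁ f = lun' Y ∘ f ∘ lun X.
Proof. by rewrite lun'_nat -compA lun'K compm1. Qed.

Lemma rw_one (X Y : A) (f : Hom X Y) : f ▷ 𝟏 = run' Y ∘ f ∘ run X.
Proof. by rewrite run'_nat -compA run'K compm1. Qed.

End Structural.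

(* [eqhs] merges adjacent structural identities into a single [eqh]; [coh] proves
   equalities whose sides then have the same generators in the same order. *)
Ltac eqhs :=
  rewrite /assoc /assoc' /lun /lun' /run /run' ?(tensmMl, tensmMr) ?compA;
  rewrite ?(eqh_rw, eqh_lw, fmap_eqh);
  repeat (match goal with
  | |- context [ _ ∘ eqh ?e' ∘ eqh ?e ] => rewrite (post2 (eqhM e' e))
  | |- context [ eqh ?e' ∘ eqh ?e ] => rewrite (eqhM e' e)
  end).

Ltac coh := eqhs; rewrite ?eqh_id ?comp1m ?compm1;
  repeat first [done | exact: eqh_irr | congr (_ ∘ _)].

(** Duality is a property of an ordered pair: a left dual of [X] is a pair with [X] as [R], a right
    dual one with [X] as [L]. Left and right duals, of objects and of modules, thus share one
    theory. *)
Record DualPair {A : MonCat} (L R : A) := {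
  dp_ev : Hom (L ⊗ R) 𝟏;
  dp_coev : Hom 𝟏 (R ⊗ L);
  dp_zigzag :
    run R ∘ (R ◁ dp_ev) ∘ assoc R L R ∘ (dp_coev ▷ R) ∘ lun' R = idm R;
  dp_zagzig :
    lun L ∘ (dp_ev ▷ L) ∘ assoc' L R L ∘ (L ◁ dp_coev) ∘ run' L = idm L }.

(** * Dual pairs *)

Section Duality.
Context {A : MonCat} {L R : A} (p : DualPair L R).

(** With [coevt] as unit, this is the counit of the adjunction [L ⊗ - ⊣ R ⊗ -]. *)
Definition evt (X : A) : Hom (L ⊗ (R ⊗ X)) X :=
  seal (lun X ∘ (dp_ev p ▷ X) ∘ assoc' L R X).

Lemma evtE (X : A) :
  evt X = lun X ∘ (dp_ev p ▷ X) ∘ assoc' L R X.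
Proof. exact: sealE. Qed.

Definition coevt (X : A) : Hom X (R ⊗ (L ⊗ X)) :=
  seal (assoc R L X ∘ (dp_coev p ▷ X) ∘ lun' X).

Lemma coevtE (X : A) :
  coevt X = assoc R L X ∘ (dp_coev p ▷ X) ∘ lun' X.
Proof. exact: sealE. Qed.

Lemma evt_nat (X Y : A) (f : Hom X Y) : f ∘ evt X = evt Y ∘ (L ◁ (R ◁ f)).
Proof.
by rewrite !evtE -[RHS]compA assoc'_nat tensm1 !compA (post2 (tensm_swap _ _)) compA lun_nat.
Qed.

Lemma coevt_nat (X Y : A) (f : Hom X Y) : (R ◁ (L ◁ f)) ∘ coevt X = coevt Y ∘ f.
Proof.
by rewrite !coevtE !compA -assoc_nat tensm1 (post2 (eq_sym (tensm_swap _ _))) !compA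
  (post2 (eq_sym (lun'_nat _))) !compA.
Qed.

Lemma evt_coevt (X : A) : evt (L ⊗ X) ∘ (L ◁ coevt X) = idm _.
Proof.
rewrite -tensm1 -[X in _ = X ▷ _](dp_zagzig p) !evtE !coevtE !tensmMl !tensmMr.
rewrite (rw_tens L X (dp_ev p)) (rw_lw L X (dp_coev p)).
coh.
Qed.

Lemma coevt_evt (X : A) : (R ◁ evt X) ∘ coevt (R ⊗ X) = idm _.
Proof.
rewrite -tensm1 -[X in _ = X ▷ _](dp_zigzag p) !evtE !coevtE !tensmMl !tensmMr.
rewrite (rw_tens R X (dp_coev p)) (rw_lw R X (dp_ev p)).
coh.
Qed.

(** With [coevr] as unit, this is the counit of the adjunction [- ⊗ R ⊣ - ⊗ L]. *)
Definition evr (X : A) : Hom ((X ⊗ L) ⊗ R) X :=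
  seal (run X ∘ (X ◁ dp_ev p) ∘ assoc X L R).

Lemma evrE (X : A) :
  evr X = run X ∘ (X ◁ dp_ev p) ∘ assoc X L R.
Proof. exact: sealE. Qed.

Definition coevr (X : A) : Hom X ((X ⊗ R) ⊗ L) :=
  seal (assoc' X R L ∘ (X ◁ dp_coev p) ∘ run' X).

Lemma coevrE (X : A) :
  coevr X = assoc' X R L ∘ (X ◁ dp_coev p) ∘ run' X.
Proof. exact: sealE. Qed.

Lemma evr_nat (X Y : A) (f : Hom X Y) : f ∘ evr X = evr Y ∘ ((f ▷ L) ▷ R).
Proof.
by rewrite !evrE -[RHS]compA assoc_nat tensm1 !compA (post2 (eq_sym (tensm_swap _ _))) compA run_nat.
Qed.

Lemma coevr_nat (X Y : A) (f : Hom X Y) : ((f ▷ R) ▷ L) ∘ coevr X = coevr Y ∘ f.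
Proof.
by rewrite !coevrE !compA -assoc'_nat tensm1 (post2 (tensm_swap _ _)) !compA
  (post2 (eq_sym (run'_nat _))) !compA.
Qed.

Lemma evr_coevr (X : A) : evr (X ⊗ R) ∘ (coevr X ▷ R) = idm _.
Proof.
rewrite -tensm1 -[X in _ = _ ◁ X](dp_zigzag p) !evrE !coevrE !tensmMl !tensmMr.
rewrite (lw_tens X R (dp_ev p)) (rw_lw X R (dp_coev p)).
coh.
Qed.

Lemma coevr_evr (X : A) : (evr X ▷ L) ∘ coevr (X ⊗ L) = idm _.
Proof.
rewrite -tensm1 -[X in _ = _ ◁ X](dp_zagzig p) !evrE !coevrE !tensmMl !tensmMr.
rewrite (lw_tens X L (dp_coev p)) (rw_lw X L (dp_ev p)).
coh.
Qed.

Lemma evr_tens (X Y : A) :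
  evr (X ⊗ Y) = (X ◁ evr Y) ∘ assoc X (Y ⊗ L) R ∘ (assoc X Y L ▷ R).
Proof. rewrite !evrE (lw_tens X Y (dp_ev p)); coh. Qed.

Lemma coevr_tens (X Y : A) :
  coevr (X ⊗ Y) = (assoc' X Y R ▷ L) ∘ assoc' X (Y ⊗ R) L ∘ (X ◁ coevr Y).
Proof. rewrite !coevrE (lw_tens X Y (dp_coev p)); coh. Qed.

Lemma ev_run : dp_ev p ∘ (L ◁ run R) = evt 𝟏.
Proof. rewrite !evtE (rw_one (dp_ev p)); coh. Qed.

Lemma ev_lun : dp_ev p ∘ (lun L ▷ R) = evr 𝟏.
Proof. rewrite !evrE (lw_one (dp_ev p)); coh. Qed.

Lemma ev_coevt : run R ∘ (R ◁ dp_ev p) ∘ coevt R = idm R.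
Proof. rewrite -[RHS](dp_zigzag p) !coevtE; coh. Qed.

Lemma ev_coevr : lun L ∘ (dp_ev p ▷ L) ∘ coevr L = idm L.
Proof. rewrite -[RHS](dp_zagzig p) !coevrE; coh. Qed.

Definition ev_curry (X : A) (b : Hom (L ⊗ X) 𝟏) : Hom X R :=
  run R ∘ (R ◁ b) ∘ coevt X.

Lemma ev_curryK (X : A) (b : Hom (L ⊗ X) 𝟏) : dp_ev p ∘ (L ◁ ev_curry b) = b.
Proof.
rewrite /ev_curry !tensmMr !compA ev_run.
by rewrite -(evt_nat b) -compA evt_coevt compm1.
Qed.

Lemma ev_curry_inj (X : A) (h h' : Hom X R) :
  dp_ev p ∘ (L ◁ h) = dp_ev p ∘ (L ◁ h') -> h = h'.
Proof.
have E (k : Hom X R) : k = ev_curry (dp_ev p ∘ (L ◁ k)).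
  rewrite /ev_curry tensmMr !compA (post2 (coevt_nat k)) compA.
  rewrite -[LHS]comp1m; congr (_ ∘ _).
  by rewrite ev_coevt.
by move=> e; rewrite (E h) (E h') e.
Qed.

Definition ev_curryl (X : A) (b : Hom (X ⊗ R) 𝟏) : Hom X L :=
  lun L ∘ (b ▷ L) ∘ coevr X.

Lemma ev_currylK (X : A) (b : Hom (X ⊗ R) 𝟏) : dp_ev p ∘ (ev_curryl b ▷ R) = b.
Proof.
rewrite /ev_curryl !tensmMl !compA ev_lun.
by rewrite -(evr_nat b) -compA evr_coevr compm1.
Qed.

Lemma ev_curryl_inj (X : A) (h h' : Hom X L) :
  dp_ev p ∘ (h ▷ R) = dp_ev p ∘ (h' ▷ R) -> h = h'.
Proof.
have E (k : Hom X L) : k = ev_curryl (dp_ev p ∘ (k ▷ R)).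
  rewrite /ev_curryl tensmMl !compA (post2 (coevr_nat k)) compA.
  rewrite -[LHS]comp1m; congr (_ ∘ _).
  by rewrite ev_coevr.
by move=> e; rewrite (E h) (E h') e.
Qed.

End Duality.

(** * Comonoidal functors and their actions on dual pairs *)

Section ComonoidalFacts.
Context {A B : MonCat} {G : Functor A B} (g : ComonoidalOn G).

Lemma cm2_natl (X X' Y : A) (f : Hom X X') :
  (fmap G f ▷ G Y) ∘ cm2 g X Y = cm2 g X' Y ∘ fmap G (f ▷ Y).
Proof. by rewrite -cm2_nat fmap1. Qed.

Lemma cm2_natr (X Y Y' : A) (f : Hom Y Y') :
  (G X ◁ fmap G f) ∘ cm2 g X Y = cm2 g X Y' ∘ fmap G (X ◁ f).
Proof. by rewrite -cm2_nat fmap1. Qed.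

Lemma cm_coassoc' (X Y Z : A) :
  assoc' _ _ _ ∘ (G X ◁ cm2 g Y Z) ∘ cm2 g X (Y ⊗ Z)
  = (cm2 g X Y ▷ G Z) ∘ cm2 g (X ⊗ Y) Z ∘ fmap G (assoc' X Y Z).
Proof.
have e := cm_coassoc g X Y Z.
have e' : fmap G (assoc X Y Z) ∘ fmap G (assoc' X Y Z) = idm _.
  by rewrite -fmapM assocK fmap1.
rewrite -[LHS]compm1 -e' !compA.
crw (eq_sym e).
by rewrite assoc'K comp1m.
Qed.

(** The counit axiom recovers [a] from its composite with [cm2]. Equations between actions can
    therefore be tested with a tail, where [evt] and [coevt] apply. *)
Lemma cm2_unit_inj (X : A) (Y : B) (a b : Hom (G X) Y) :
  (a ▷ G 𝟏) ∘ cm2 g X 𝟏 = (b ▷ G 𝟏) ∘ cm2 g X 𝟏 -> a = b.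
Proof.
have E (k : Hom (G X) Y) :
    k = run Y ∘ (Y ◁ cm0 g) ∘ ((k ▷ G 𝟏) ∘ cm2 g X 𝟏) ∘ fmap G (run' X).
  rewrite !compA (post2 (eq_sym (tensm_swap _ _))) !compA run_nat.
  crw (cm_counitr g X).
  by rewrite -compA -fmapM runK fmap1 compm1.
by move=> e; rewrite (E a) (E b) e.
Qed.

End ComonoidalFacts.

Section ActionsOnDuals.
Context {A : MonCat} {G : Functor A A} (g : ComonoidalOn G) {L R : A} (p : DualPair L R).

(** When [l] and [r] are module structures, this says that the evaluation is a morphism of modules.
    No module axiom is imposed, so that [G] can also be a composite [F ∘F F] or the identity
    functor. *)
Definition ev_linear (l : Hom (G L) L) (r : Hom (G R) R) : Prop :=
  dp_ev p ∘ (l ⊗m r) ∘ cm2 g L R = cm0 g ∘ fmap G (dp_ev p).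

Definition coev_linear (l : Hom (G L) L) (r : Hom (G R) R) : Prop :=
  (r ⊗m l) ∘ cm2 g R L ∘ fmap G (dp_coev p) = dp_coev p ∘ cm0 g.

Lemma ev_linear_evt l r (X : A) : ev_linear l r ->
  evt p (G X) ∘ (l ⊗m (r ▷ G X)) ∘ (G L ◁ cm2 g R X) ∘ cm2 g L (R ⊗ X)
  = fmap G (evt p X).
Proof.
move=> e; rewrite !evtE !fmapM -(cm_counitl g).
crw (assoc'_nat l r (idm (G X))).
crw (cm_coassoc' g L R X).
have e1 := f_equal (fun f => f ▷ G X) e; rewrite /= !tensmMl in e1.
crw e1.
by crw (cm2_natl g X (dp_ev p)).
Qed.

Lemma coev_linear_coevt l r (X : A) : coev_linear l r ->
  (r ⊗m (l ▷ G X)) ∘ (G R ◁ cm2 g L X) ∘ cm2 g R (L ⊗ X) ∘ fmap G (coevt p X)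
  = coevt p (G X).
Proof.
move=> e; rewrite !coevtE !fmapM !compA.
crw (eq_sym (cm_coassoc g R L X)).
crw (eq_sym (cm2_natl g X (dp_coev p))).
rewrite -assoc_nat.
have e1 := f_equal (fun f => f ▷ G X) e; rewrite /= !tensmMl in e1.
crw e1.
rewrite -!compA; congr (_ ∘ (_ ∘ _)).
have := f_equal (fun f => lun' _ ∘ f ∘ fmap G (lun' X)) (cm_counitl g X).
rewrite !compA lun'K comp1m => ->.
by rewrite -compA -fmapM lunK fmap1 compm1.
Qed.

(* [l] and [l'] are both equal to [ev ∘ (l ⊗ r ⊗ l') ∘ coev], as a left
   and a right inverse of the same element coincide. *)
Lemma linear_unique_l l l' r : ev_linear l r -> coev_linear l' r -> l = l'.
Proof.
move=> el cl; apply: (@cm2_unit_inj _ _ _ g); set X := 𝟏.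
have e := coev_linear_coevt X cl; have e' := ev_linear_evt (L ⊗ X) el.
rewrite -[LHS]comp1m -(evt_coevt p (G X)) -e !tensmMr !compA.
crw (eq_sym (tensm_swap l (fmap G (coevt p X)))).
crw (eq_sym (tensm_swap l (cm2 g R (L ⊗ X)))).
crw (eq_sym (tensm_swap l (G R ◁ cm2 g L X))).
crw (tensm_rl l (r ⊗m (l' ▷ G X))).
crw (cm2_natr g L (coevt p X)).
have e2 : (l ⊗m (r ⊗m (l' ▷ G X))) ∘ (G L ◁ (G R ◁ cm2 g L X))
  = (L ◁ (R ◁ ((l' ▷ G X) ∘ cm2 g L X))) ∘ (l ⊗m (r ▷ G (L ⊗ X))).
  by rewrite -!tensmM !comp1m !compm1.
crw e2; rewrite -(evt_nat p); crw e'.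
by rewrite -compA -fmapM evt_coevt fmap1 compm1.
Qed.

(** The mirror image of [linear_unique_l]: the identity on [R ⊗ X] is expanded instead of the one on
    [L ⊗ X]. *)
Lemma linear_unique_r l r r' : ev_linear l r -> coev_linear l r' -> r = r'.
Proof.
move=> el cl; apply: (@cm2_unit_inj _ _ _ g); set X := 𝟏.
have e := coev_linear_coevt (R ⊗ X) cl; have e' := ev_linear_evt X el.
rewrite -[LHS]comp1m -(coevt_evt p (G X)) !compA.
rewrite -(compA _ (r ▷ _)); crw (eq_sym (coevt_nat p ((r ▷ G X) ∘ cm2 g R X))).
rewrite -e !compA.
have e2 : (R ◁ evt p (G X)) ∘ (R ◁ (L ◁ ((r ▷ G X) ∘ cm2 g R X))) ∘ (r' ⊗m (l ▷ G (R ⊗ X)))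
    ∘ (G R ◁ cm2 g L (R ⊗ X))
  = (r' ▷ G X) ∘ (G R ◁ fmap G (evt p X)).
  rewrite -e' -!tensmM ?comp1m ?compm1; congr (_ ⊗m (_ ∘ _)).
  by rewrite -!compA -!tensmM ?comp1m ?compm1.
crw e2; crw (cm2_natr g R (evt p X)).
by rewrite -compA -fmapM coevt_evt fmap1 compm1.
Qed.

End ActionsOnDuals.

(** * Transposition of morphisms between dual pairs *)

Section Mates.
Context {A : MonCat} {L R L' R' : A} (p : DualPair L R) (p' : DualPair L' R').

Definition mates (h : Hom L' L) (f : Hom R R') : Prop :=
  dp_ev p ∘ (h ▷ R) = dp_ev p' ∘ (L' ◁ f).

Lemma mates_coev h f : mates h f -> (f ▷ L) ∘ dp_coev p = (R' ◁ h) ∘ dp_coev p'.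
Proof.
rewrite /mates => e.
(* Tensoring with [R] and applying the counit is transposition along [- ⊗ R ⊣ - ⊗ L], hence
   injective. After it, the zigzag identities reduce both sides to [f]. *)
have inj (x y : Hom 𝟏 (R' ⊗ L)) :
    evr p R' ∘ (x ▷ R) = evr p R' ∘ (y ▷ R) -> x = y.
  have E (z : Hom 𝟏 (R' ⊗ L)) :
      z = ((evr p R' ∘ (z ▷ R)) ▷ L) ∘ coevr p 𝟏.
    by rewrite tensmMl -compA (coevr_nat p z) compA coevr_evr comp1m.
  by move=> exy; rewrite (E x) (E y) exy.
apply: inj; rewrite !tensmMl !compA -(evr_nat p f) !evrE !compA.
crw (assoc_nat (idm R') h (idm R)).
have e1 := f_equal (fun k => R' ◁ k) e; rewrite /= !tensmMr in e1.
crw e1.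
crw (eq_sym (assoc_nat (idm R') (idm L') f)).
rewrite tensm1; crw (eq_sym (tensm_swap (dp_coev p') f)).
have z : run R ∘ (R ◁ dp_ev p) ∘ assoc R L R ∘ (dp_coev p ▷ R) = lun R.
  by rewrite -[RHS]comp1m -[X in _ = X ∘ _](dp_zigzag p); crw (lun'K R).
have z' : run R' ∘ (R' ◁ dp_ev p') ∘ assoc R' L' R' ∘ (dp_coev p' ▷ R') = lun R'.
  by rewrite -[RHS]comp1m -[X in _ = X ∘ _](dp_zigzag p'); crw (lun'K R').
by crw z; crw z'; rewrite lun_nat.
Qed.

Lemma mates_inj_l h h' f : mates h f -> mates h' f -> h = h'.
Proof. by move=> e e'; apply: (ev_curryl_inj (p := p)); rewrite e e'. Qed.

Lemma mates_inj_r h f f' : mates h f -> mates h f' -> f = f'.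
Proof. by move=> e e'; apply: (ev_curry_inj (p := p')); rewrite -e -e'. Qed.

End Mates.

Lemma mates_comp {A : MonCat} {L R L' R' L'' R'' : A} (p : DualPair L R)
    (p' : DualPair L' R') (p'' : DualPair L'' R'') h f h' f' :
  mates p p' h f -> mates p' p'' h' f' -> mates p p'' (h ∘ h') (f' ∘ f).
Proof.
rewrite /mates tensmMl tensmMr !compA => -> <-.
by rewrite -!compA tensm_swap.
Qed.

Lemma mates_id {A : MonCat} {L R : A} (p : DualPair L R) : mates p p (idm L) (idm R).
Proof. by []. Qed.

(** * Actions on the two members of a dual pair *)

Section LinearPairs.
Context {A : MonCat} {L R : A} (p : DualPair L R).

Definition linear_pair {G : Functor A A} (g : ComonoidalOn G) (l : Hom (G L) L)
    (r : Hom (G R) R) : Prop :=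
  ev_linear g p l r /\ coev_linear g p l r.

Lemma linear_pair_id : linear_pair (id_comon A) (idm L) (idm R).
Proof. by split; rewrite /ev_linear /coev_linear /= ?tensm1 ?comp1m ?compm1. Qed.

Lemma linear_pair_comp {G F : Functor A A} (g : ComonoidalOn G) (f : ComonoidalOn F) l r l' r' :
  linear_pair g l r -> linear_pair f l' r' ->
  linear_pair (comp_comon g f) (l ∘ fmap G l') (r ∘ fmap G r').
Proof.
move=> [e c] [e' c']; split; rewrite /ev_linear /coev_linear /= tensmM ?compA.
- crw (cm2_nat g l' r'); crw e.
  by rewrite -!compA -!fmapM !compA e'.
- crw (cm2_nat g r' l'); rewrite -!compA -!fmapM !compA c' fmapM !compA.
  by rewrite c.
Qed.

Lemma linear_pair_nat {G F : Functor A A} (g : ComonoidalOn G) (f : ComonoidalOn F)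
    (a : Nat F G) l r :
  comonoidal_nat f g a -> linear_pair g l r -> linear_pair f (l ∘ a L) (r ∘ a R).
Proof.
move=> [a2 a0] [e c]; split; rewrite /ev_linear /coev_linear /= tensmM ?compA.
- crw (eq_sym (a2 L R)); crw e.
  by rewrite -a0 -!compA nat_nat.
- crw (eq_sym (a2 R L)); rewrite -compA -nat_nat !compA.
  by rewrite c -compA a0.
Qed.

Section Bimonad.
Context {F : Functor A A} (b : BimonadOn F) (l : Hom (F L) L) (r : Hom (F R) R).
Hypothesis lr : linear_pair b l r.

(** Linear pairs compose and pull back along the comonoidal transformation [μ]. So [l ∘ F l] is
    paired with [r ∘ F r], and [l ∘ μ] with [r ∘ μ]; these actions of [F ∘F F] on [R] agree, and an
    action on [R] has at most one partner. The three lemmas that follow use the same argument. *)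
Lemma dual_act_mu_l : r ∘ fmap F r = r ∘ mu b R -> l ∘ fmap F l = l ∘ mu b L.
Proof.
move=> e; have [e1 c1] := linear_pair_comp lr lr.
have [e2 c2] := linear_pair_nat (mu_comon b) lr.
by rewrite e in e1; apply: (linear_unique_l e1 c2).
Qed.

Lemma dual_act_eta_l : r ∘ eta b R = idm R -> l ∘ eta b L = idm L.
Proof.
move=> e; have [e1 c1] := linear_pair_nat (eta_comon b) lr.
have [e2 c2] := linear_pair_id.
by rewrite e in e1; apply: (linear_unique_l e1 c2).
Qed.

Lemma dual_act_mu_r : l ∘ fmap F l = l ∘ mu b L -> r ∘ fmap F r = r ∘ mu b R.
Proof.
move=> e; have [e1 c1] := linear_pair_comp lr lr.
have [e2 c2] := linear_pair_nat (mu_comon b) lr.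
by rewrite e in e1; apply: (linear_unique_r e1 c2).
Qed.

Lemma dual_act_eta_r : l ∘ eta b L = idm L -> r ∘ eta b R = idm R.
Proof.
move=> e; have [e1 c1] := linear_pair_nat (eta_comon b) lr.
have [e2 c2] := linear_pair_id.
by rewrite e in e1; apply: (linear_unique_r e1 c2).
Qed.

End Bimonad.
End LinearPairs.

(** * Duals of modules over a Hopf monad *)

Section AutonomousDuals.
Context {C : AutCat}.

Definition lpair (X : C) : DualPair (ldual X) X :=
  Build_DualPair (ldual_zigzag X) (ldual_zagzig X).

Definition rpair (X : C) : DualPair X (rdual X) :=
  Build_DualPair (rdual_zagzig X) (rdual_zigzag X).

Lemma ldualm_mates (X Y : C) (f : Hom X Y) : mates (lpair X) (lpair Y) (ldualm f) f.
Proof.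
rewrite /mates -[RHS](ev_currylK (lpair X)).
congr (_ ∘ (_ ▷ _)); rewrite /ev_curryl coevrE /ldualm /= !tensmMl (rw_lw _ _ f).
coh.
Qed.

Lemma rdualm_mates (X Y : C) (f : Hom X Y) : mates (rpair Y) (rpair X) f (rdualm f).
Proof.
rewrite /mates -[LHS](ev_curryK (rpair X)).
congr (_ ∘ (_ ◁ _)); rewrite /ev_curry coevtE /rdualm /= !tensmMr (rw_lw _ _ f).
coh.
Qed.

Lemma ldualm_comp (X Y Z : C) (g : Hom Y Z) (f : Hom X Y) :
  ldualm (g ∘ f) = ldualm f ∘ ldualm g.
Proof.
apply: (mates_inj_l (ldualm_mates (g ∘ f))).
exact: mates_comp (ldualm_mates f) (ldualm_mates g).
Qed.

Lemma rdualm_comp (X Y Z : C) (g : Hom Y Z) (f : Hom X Y) :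
  rdualm (g ∘ f) = rdualm f ∘ rdualm g.
Proof.
apply: (mates_inj_r (rdualm_mates (g ∘ f))).
exact: mates_comp (rdualm_mates g) (rdualm_mates f).
Qed.

Lemma ldualm_id (X : C) : ldualm (idm X) = idm (ldual X).
Proof. exact: (mates_inj_l (ldualm_mates (idm X)) (mates_id _)). Qed.

Lemma rdualm_id (X : C) : rdualm (idm X) = idm (rdual X).
Proof. exact: (mates_inj_r (rdualm_mates (idm X)) (mates_id _)). Qed.

End AutonomousDuals.

Section HopfDuals.
Context {C : AutCat} (T : HopfMonad C).

Local Notation T2 := (cm2 (bi_comon T)).
Local Notation T0 := (cm0 (bi_comon T)).

(** For the evaluation, naturality of [s] and the transposed axiom [act ∘ T act = act ∘ μ] produce
    the side of the antipode axiom that contains [μ]; its other side contains [η], which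
    [act ∘ η = id] cancels. For the coevaluation, the transposed action is first moved to the other
    factor by [mates_coev]. *)
Lemma ldual_linear_pair s (M : ModMon T) : is_left_antipode s ->
  linear_pair (lpair (car M)) (bi_comon T)
    (s (car M) ∘ fmap T (ldualm (act M))) (act M).
Proof.
case=> sn se sc; have rr := f_equal (fun k => ldualm k) (act_mu M).
rewrite /= !ldualm_comp in rr.
split; rewrite /ev_linear /coev_linear.
- rewrite -tensm_rl compA -(ldualm_mates (act M)).
  rewrite -(compA (dp_ev _)) -tensmMl compA sn -!compA -fmapM rr fmapM.
  rewrite !tensmMl !compA.
  crw (cm2_natl (bi_comon T) (car M) (ldualm (act M))).
  have e := se (car M); rewrite tensmMl !compA in e.
  crw (eq_sym e).
  rewrite -!compA -!fmapM -tensmMl -ldualm_comp act_eta ldualm_id tensm1.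
  by rewrite compm1.
- have e := mates_coev (ldualm_mates (act M)); rewrite /= in e.
  have -> : act M ⊗m (s (car M) ∘ fmap T (ldualm (act M)))
    = (act M ⊗m s (car M)) ∘ (T (car M) ◁ fmap T (ldualm (act M))).
    by rewrite -tensmM compm1.
  crw (cm2_natr (bi_comon T) (car M) (ldualm (act M))).
  rewrite -compA -fmapM -e fmapM compA.
  crw (eq_sym (cm2_natl (bi_comon T) (ldual (T (car M))) (act M))).
  have e1 : (act M ⊗m s (car M)) ∘ (fmap T (act M) ▷ T (ldual (T (car M))))
    = (act M ▷ ldual (car M)) ∘ (μ T (car M) ⊗m s (car M)).
    by rewrite -!tensmM act_mu compm1 comp1m.
  crw e1; crw (eq_sym (sc (car M))).
  by rewrite -tensmMl act_eta tensm1 comp1m.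
Qed.

Lemma rdual_linear_pair s (M : ModMon T) : is_right_antipode s ->
  linear_pair (rpair (car M)) (bi_comon T)
    (act M) (s (car M) ∘ fmap T (rdualm (act M))).
Proof.
case=> sn se sc; have rr := f_equal (fun k => rdualm k) (act_mu M).
rewrite /= !rdualm_comp in rr.
split; rewrite /ev_linear /coev_linear.
- rewrite -tensm_lr compA (rdualm_mates (act M)).
  rewrite -(compA (dp_ev _)) -tensmMr compA sn -!compA -fmapM rr fmapM.
  rewrite !tensmMr !compA.
  crw (cm2_natr (bi_comon T) (car M) (rdualm (act M))).
  have e := se (car M); rewrite tensmMr !compA in e.
  crw (eq_sym e).
  rewrite -!compA -!fmapM -tensmMr -rdualm_comp act_eta rdualm_id tensm1.
  by rewrite compm1.
- have e := mates_coev (rdualm_mates (act M)); rewrite /= in e.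
  have -> : (s (car M) ∘ fmap T (rdualm (act M))) ⊗m act M
    = (s (car M) ⊗m act M) ∘ (fmap T (rdualm (act M)) ▷ T (car M)).
    by rewrite -tensmM compm1.
  crw (cm2_natl (bi_comon T) (car M) (rdualm (act M))).
  rewrite -compA -fmapM e fmapM compA.
  crw (eq_sym (cm2_natr (bi_comon T) (rdual (T (car M))) (act M))).
  have e1 : (s (car M) ⊗m act M) ∘ (T (rdual (T (car M))) ◁ fmap T (act M))
    = (rdual (car M) ◁ act M) ∘ (s (car M) ⊗m μ T (car M)).
    by rewrite -!tensmM act_mu compm1 comp1m.
  crw e1; crw (eq_sym (sc (car M))).
  by rewrite -tensmMr act_eta tensm1 comp1m.
Qed.

End HopfDuals.

(** * Dual pairs of modules and of their carriers *)

Section ModuleStructural.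
Context {C : MonCat} {T : Bimonad C}.

Lemma lin_assoc' (M N P : ModMon T) : lin (assoc' M N P) = assoc' (car M) (car N) (car P).
Proof. exact: (@lin_eqh _ _ (tens_mod _ _) (tens_mod _ _)). Qed.

Lemma lin_lun' (M : ModMon T) : lin (lun' M) = lun' (car M).
Proof. exact: (@lin_eqh _ _ _ (tens_mod _ _)). Qed.

Lemma lin_run' (M : ModMon T) : lin (run' M) = run' (car M).
Proof. exact: (@lin_eqh _ _ _ (tens_mod _ _)). Qed.

Lemma lin_comp (M N P : ModMon T) (g : Hom N P) (f : Hom M N) :
  lin (g ∘ f) = lin g ∘ lin f.
Proof. by []. Qed.

Lemma lin_tens (M M' N N' : ModMon T) (f : Hom M M') (g : Hom N N') :
  lin (f ⊗m g) = lin f ⊗m lin g.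
Proof. by []. Qed.

Lemma lin_idm (M : ModMon T) : lin (idm M) = idm (car M).
Proof. by []. Qed.

Lemma module_pair (L R : ModMon T) (p : DualPair (car L) (car R)) :
  linear_pair p (bi_comon T) (act L) (act R) -> inhabited (DualPair L R).
Proof.
rewrite /linear_pair /ev_linear /coev_linear => -[e c].
have e' : dp_ev p ∘ act (tens_mod L R) = act (one_mod T) ∘ fmap T (dp_ev p).
  by rewrite /= compA.
have c' : dp_coev p ∘ act (one_mod T) = act (tens_mod R L) ∘ fmap T (dp_coev p).
  by rewrite /= -c.
constructor; unshelve refine (@Build_DualPair (ModMon T) L R
  (@Build_LinHom C T (tens_mod L R) (one_mod T) _ e')
  (@Build_LinHom C T (one_mod T) (tens_mod R L) _ c') _ _).
- apply: lin_eq; rewrite !lin_comp !lin_tens lin_run lin_assoc lin_lun'.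
  exact: dp_zigzag.
- apply: lin_eq; rewrite !lin_comp !lin_tens lin_lun lin_assoc' lin_run'.
  exact: dp_zagzig.
Qed.

Definition forget_pair (L R : ModMon T) (p : DualPair L R) : DualPair (car L) (car R).
Proof.
unshelve refine (@Build_DualPair C (car L) (car R) (lin (dp_ev p)) (lin (dp_coev p)) _ _).
- have := f_equal lin (dp_zigzag p).
  by rewrite !lin_comp !lin_tens lin_run lin_assoc lin_lun'.
- have := f_equal lin (dp_zagzig p).
  by rewrite !lin_comp !lin_tens lin_lun lin_assoc' lin_run'.
Defined.

Lemma lin_evt (L R : ModMon T) (p : DualPair L R) (X : ModMon T) :
  lin (evt p X) = evt (forget_pair p) (car X).
Proof. by rewrite !evtE !lin_comp !lin_tens lin_lun lin_assoc'. Qed.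

Lemma lin_coevt (L R : ModMon T) (p : DualPair L R) (X : ModMon T) :
  lin (coevt p X) = coevt (forget_pair p) (car X).
Proof. by rewrite !coevtE !lin_comp !lin_tens lin_assoc lin_lun'. Qed.

End ModuleStructural.

(** Stated as existence because the antipodes of a Hopf monad, from which duals of modules are
    built, are only known to exist. *)
Definition has_left_duals (A : MonCat) : Prop :=
  forall R : A, exists L : A, inhabited (DualPair L R).

Lemma has_left_duals_autonomous (C : AutCat) : has_left_duals C.
Proof. by move=> R; exists (ldual R); split; exact: lpair. Qed.

(** The antipode supplies the action on the dual; its module axioms come from those of [M] by
    uniqueness of the partner action. *)
Lemma has_left_duals_modules (C : AutCat) (T : HopfMonad C) : has_left_duals (ModMon T).
Proof.
move=> M; have [s hs] := hopf_left T.
have lp := ldual_linear_pair M hs.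
have mu := dual_act_mu_l (b := bi_on T) lp (act_mu M).
have eta := dual_act_eta_l (b := bi_on T) lp (act_eta M).
pose L : ModMon T := @Build_Module C T _ _ mu eta.
by exists L; exact: (@module_pair C T L M _ lp).
Qed.

Lemma has_right_duals_modules (C : AutCat) (T : HopfMonad C) (M : ModMon T) :
  exists N : ModMon T, inhabited (DualPair M N).
Proof.
have [s hs] := hopf_right T.
have lp := rdual_linear_pair M hs.
have mu := dual_act_mu_r (b := bi_on T) lp (act_mu M).
have eta := dual_act_eta_r (b := bi_on T) lp (act_eta M).
pose N : ModMon T := @Build_Module C T _ _ mu eta.
by exists N; exact: (@module_pair C T M N _ lp).
Qed.

(** * Cofree modules *)

Section FreeModules.
Context {C : MonCat} {T : Bimonad C}.

Lemma free_ext (X : C) (M : ModMon T) (g : Hom X (car M)) :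
  lin (counitM M ∘ fmap (freeM T) g) ∘ η T X = g.
Proof.
rewrite lin_comp -compA /= [fmap T g ∘ _](eta_nat (mon_on T)) compA.
by rewrite (act_eta M) comp1m.
Qed.

Lemma free_inj (X : C) (M : ModMon T) (h h' : Hom (freeM T X) M) :
  lin h ∘ η T X = lin h' ∘ η T X -> h = h'.
Proof.
have E (k : Hom (freeM T X) M) : lin k = act M ∘ fmap T (lin k ∘ η T X).
  rewrite fmapM compA -(lin_act k) -compA /=.
  by rewrite (mu_etar (mon_on T)) compm1.
by move=> e; apply: lin_eq; rewrite (E h) (E h') e.
Qed.

(* [e : K → W] exhibits [K] as the value at [W] of a right adjoint of [U_T]. *)
Definition cofree (W : C) (K : ModMon T) (e : Hom (car K) W) : Prop :=
  (forall (M : ModMon T) (g : Hom (car M) W), exists h : Hom M K, e ∘ lin h = g) /\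
  (forall (M : ModMon T) (h h' : Hom M K), e ∘ lin h = e ∘ lin h' -> h = h').

(** The adjunction [L ⊗ - ⊣ N ⊗ -] of modules lies over the one of carriers. A map [M → N ⊗ W] is
    transposed to [L ⊗ M → W], lifted to [K], and transposed back as a linear map. *)
Lemma cofree_tens (N L : ModMon T) (p : DualPair L N) (W : C) (K : ModMon T)
    (e : Hom (car K) W) :
  cofree e -> cofree (K := N ⊗ K) (car N ◁ e).
Proof.
move=> [ex inj]; split=> [M g|M h h' E].
- have [k ek] := ex (L ⊗ M) (evt (forget_pair p) W ∘ (car L ◁ g)).
  exists ((N ◁ k) ∘ coevt p M).
  rewrite lin_comp lin_tens lin_idm lin_coevt compA -tensmMr ek tensmMr.
  by crw (coevt_nat (forget_pair p) g); rewrite coevt_evt comp1m.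
- have D (k : Hom M (N ⊗ K)) : k = (N ◁ (evt p K ∘ (L ◁ k))) ∘ coevt p M.
    by rewrite tensmMr -compA coevt_nat compA coevt_evt comp1m.
  rewrite (D h) (D h'); congr ((_ ◁ _) ∘ _); apply: inj.
  rewrite !lin_comp !lin_tens lin_evt !lin_idm !compA.
  rewrite !(evt_nat (forget_pair p) e) -!compA -!tensmMr.
  by congr (_ ∘ (_ ◁ _)).
Qed.

End FreeModules.

Section Cofree.
Context {C : AutCat} {T : HopfMonad C}.

(** A pairing with [M] is a map into its left dual [L], and a map [A → L] extends to a linear map on
    the free module. *)
Lemma free_pairing (A : C) (M : ModMon T) (b : Hom (A ⊗ car M) 𝟏) :
  exists β : Hom (freeM T A ⊗ M) 𝟏, lin β ∘ (η T A ▷ car M) = b.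
Proof.
have [L [p]] := has_left_duals_modules M.
exists (dp_ev p ∘ ((counitM L ∘ fmap (freeM T) (ev_curryl (forget_pair p) b)) ▷ M)).
rewrite lin_comp lin_tens lin_idm -compA -tensmMl.
rewrite (free_ext (ev_curryl (forget_pair p) b)).
exact: (ev_currylK (forget_pair p) b).
Qed.

Lemma free_pairing_inj (A : C) (M : ModMon T) (β β' : Hom (freeM T A ⊗ M) 𝟏) :
  lin β ∘ (η T A ▷ car M) = lin β' ∘ (η T A ▷ car M) -> β = β'.
Proof.
have [L [p]] := has_left_duals_modules M.
rewrite -(ev_currylK p β) -(ev_currylK p β').
move: (ev_curryl p β) (ev_curryl p β') => k k' e.
congr (_ ∘ (_ ▷ _)); apply: free_inj; apply: (ev_curryl_inj (p := forget_pair p)).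
by rewrite !tensmMl !compA; exact: e.
Qed.

Lemma cofree_exists (W : C) : exists (K : ModMon T) (e : Hom (car K) W), cofree e.
Proof.
(* The cofree module on [W] is the right dual of the free module on the left dual of [W]: linear
   maps [M → K] are linear pairings of that free module with [M], hence pairings of [ldual W] with
   [M] in [C], hence maps [M → W]. *)
have [K [p]] := has_right_duals_modules (freeM T (ldual W)).
exists K, (ev_curry (lpair W) (lin (dp_ev p) ∘ (η T (ldual W) ▷ car K))).
set e := ev_curry _ _.
have E (M : ModMon T) (h : Hom M K) :
  dp_ev (lpair W) ∘ (ldual W ◁ (e ∘ lin h))
  = lin (dp_ev p ∘ (freeM T (ldual W) ◁ h)) ∘ (η T (ldual W) ▷ car M).
  rewrite tensmMr compA ev_curryK lin_comp lin_tens lin_idm -!compA.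
  by rewrite tensm_swap.
split=> [M g|M h h' eh].
- have [β eβ] := free_pairing (dp_ev (lpair W) ∘ (ldual W ◁ g)).
  exists (ev_curry p β); apply: (ev_curry_inj (p := lpair W)).
  by rewrite E ev_curryK.
- apply: (ev_curry_inj (p := p)); apply: free_pairing_inj.
  by rewrite -!E eh.
Qed.

Lemma cofree_tens_exists (W : C) : exists (K : ModMon T) (e : Hom (car K) W),
  cofree e /\ forall N : ModMon T, cofree (K := N ⊗ K) (car N ◁ e).
Proof.
have [K [e ce]] := cofree_exists W; exists K, e; split=> // N.
by have [L [p]] := has_left_duals_modules N; apply: (cofree_tens p ce).
Qed.

End Cofree.

(** * The monad and bimonad structures of a centralizer *)

Section CentralizerTails.
Context {A : MonCat} {P : Functor A A} (Z : Centralizer P).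

Lemma cz_natl (X X' Y : A) (f : Hom X X') :
  (P Y ◁ fmap Z f) ∘ cz_map Z X Y = cz_map Z X' Y ∘ (f ▷ Y).
Proof. by rewrite -cz_nat fmap1. Qed.

Lemma cz_natr (X Y Y' : A) (g : Hom Y Y') :
  (fmap P g ▷ Z X) ∘ cz_map Z X Y = cz_map Z X Y' ∘ (X ◁ g).
Proof. by rewrite -cz_nat fmap1. Qed.

Lemma cz_ext (X W : A) (f g : Hom (Z X) W) :
  (forall Y, (P Y ◁ f) ∘ cz_map Z X Y = (P Y ◁ g) ∘ cz_map Z X Y) -> f = g.
Proof.
move=> e.
have nat (Y Y' : A) (k : Hom Y Y') :
    (fmap P k ▷ W) ∘ ((P Y ◁ f) ∘ cz_map Z X Y) = ((P Y' ◁ f) ∘ cz_map Z X Y') ∘ (X ◁ k).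
  by rewrite compA tensm_swap -!compA cz_natr.
have [r [_ u]] := @cz_univ _ _ Z X W (fun Y => (P Y ◁ f) ∘ cz_map Z X Y) nat.
by rewrite -(u f) // -(u g).
Qed.

(* [∂_{X,Y} ⊗ V], rebracketed to the right. *)
Definition dt (X Y V : A) : Hom (X ⊗ (Y ⊗ V)) (P Y ⊗ (Z X ⊗ V)) :=
  seal (assoc (P Y) (Z X) V ∘ (cz_map Z X Y ▷ V) ∘ assoc' X Y V).

Lemma dtE (X Y V : A) :
  dt X Y V = assoc (P Y) (Z X) V ∘ (cz_map Z X Y ▷ V) ∘ assoc' X Y V.
Proof. exact: sealE. Qed.

Lemma dt_natX (X X' Y V : A) (f : Hom X X') :
  (P Y ◁ (fmap Z f ▷ V)) ∘ dt X Y V = dt X' Y V ∘ (f ▷ (Y ⊗ V)).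
Proof.
rewrite !dtE !compA -assoc_nat.
have e := f_equal (fun k => k ▷ V) (cz_natl Y f); rewrite /= !tensmMl in e.
by crw e; rewrite -[in RHS]compA -(tensm1 Y V) assoc'_nat compA.
Qed.

Lemma dt_natY (X Y Y' V : A) (g : Hom Y Y') :
  (fmap P g ▷ (Z X ⊗ V)) ∘ dt X Y V = dt X Y' V ∘ (X ◁ (g ▷ V)).
Proof.
rewrite !dtE !compA -(tensm1 (Z X) V) -assoc_nat.
have e := f_equal (fun k => k ▷ V) (cz_natr X g); rewrite /= !tensmMl in e.
by crw e; rewrite -[in RHS]compA assoc'_nat compA.
Qed.

Lemma dt_natV (X Y V V' : A) (h : Hom V V') :
  (P Y ◁ (Z X ◁ h)) ∘ dt X Y V = dt X Y V' ∘ (X ◁ (Y ◁ h)).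
Proof.
rewrite !dtE !compA -assoc_nat tensm1.
crw (eq_sym (tensm_swap (cz_map Z X Y) h)).
by rewrite -[in RHS]compA assoc'_nat tensm1 compA.
Qed.

Lemma dt_tens (X Y V W : A) :
  dt X Y (V ⊗ W)
  = (P Y ◁ assoc (Z X) V W) ∘ assoc _ _ _ ∘ (dt X Y V ▷ W)
      ∘ assoc' _ _ _ ∘ (X ◁ assoc' Y V W).
Proof. rewrite !dtE (rw_tens V W (cz_map Z X Y)); coh. Qed.

Lemma dt_one (X Y : A) : (P Y ◁ run (Z X)) ∘ dt X Y 𝟏 = cz_map Z X Y ∘ (X ◁ run Y).
Proof. rewrite dtE (rw_one (cz_map Z X Y)); coh. Qed.

Hypothesis hd : has_left_duals A.

(** A left dual [L] of [V] turns [Z X ⊗ V → W] into [Z X → W ⊗ L], where the universal property of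
    [∂] itself applies. *)
Lemma dt_ext (X V W : A) (f g : Hom (Z X ⊗ V) W) :
  (forall Y, (P Y ◁ f) ∘ dt X Y V = (P Y ◁ g) ∘ dt X Y V) -> f = g.
Proof.
move=> e; have [L [p]] := hd V.
have E (k : Hom (Z X ⊗ V) W) : k = evr p W ∘ (((k ▷ L) ∘ coevr p (Z X)) ▷ V).
  by rewrite tensmMl compA -(evr_nat p) -compA evr_coevr compm1.
rewrite (E f) (E g); congr (_ ∘ (_ ▷ _)); apply: cz_ext => Y.
have D (k : Hom (Z X ⊗ V) W) : (P Y ◁ ((k ▷ L) ∘ coevr p (Z X))) ∘ cz_map Z X Y
    = assoc _ _ _ ∘ (((P Y ◁ k) ∘ dt X Y V) ▷ L) ∘ assoc' _ _ _ ∘ (X ◁ coevr p Y).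
  have c := coevr_nat p (cz_map Z X Y).
  rewrite !coevr_tens in c.
  have c' : (P Y ◁ coevr p (Z X)) ∘ cz_map Z X Y
    = assoc (P Y) (Z X ⊗ V) L ∘ (assoc (P Y) (Z X) V ▷ L) ∘
       ((cz_map Z X Y ▷ V) ▷ L) ∘ ((assoc' X Y V ▷ L) ∘ assoc' X (Y ⊗ V) L ∘ (X ◁ coevr p Y)).
    crw c; rewrite -[X in X ∘ _ = _]comp1m; congr (_ ∘ _ ∘ _); coh.
  rewrite tensmMr -compA c' dtE !tensmMl !compA.
  by rewrite -(assoc_nat (idm (P Y)) k (idm L)).
by rewrite !D e.
Qed.

Lemma dt_univ (X V W : A) (xi : forall Y : A, Hom (X ⊗ (Y ⊗ V)) (P Y ⊗ W)) :
  (forall (Y Y' : A) (g : Hom Y Y'),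
     (fmap P g ▷ W) ∘ xi Y = xi Y' ∘ (X ◁ (g ▷ V))) ->
  exists f : Hom (Z X ⊗ V) W, forall Y, (P Y ◁ f) ∘ dt X Y V = xi Y.
Proof.
move=> nat; have [L [p]] := hd V.
(* The family [xi] transposed along [- ⊗ V ⊣ - ⊗ L]; the map induced by it is transposed back. *)
pose xi' Y := assoc _ _ _ ∘ (xi Y ▷ L) ∘ assoc' _ _ _ ∘ (X ◁ coevr p Y).
have nat' Y Y' (g : Hom Y Y') : (fmap P g ▷ (W ⊗ L)) ∘ xi' Y = xi' Y' ∘ (X ◁ g).
  rewrite /xi' !compA -(tensm1 W L) -assoc_nat.
  have e := f_equal (fun k => k ▷ L) (nat _ _ g); rewrite /= !tensmMl in e.
  crw e; crw (eq_sym (assoc'_nat (idm X) (g ▷ V) (idm L))).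
  by rewrite -!compA -!tensmMr coevr_nat.
have [r [er _]] := @cz_univ _ _ Z X (W ⊗ L) xi' nat'.
exists (evr p W ∘ (r ▷ V)) => Y.
have e := f_equal (fun k => k ▷ V) (er Y); rewrite /xi' /= !tensmMl in e.
have evP := evr_tens p (P Y) W; have evX := evr_tens p X (Y ⊗ V).
rewrite dtE !tensmMr !compA; crw (eq_sym (assoc_nat (idm (P Y)) r (idm V))).
crw (eq_sym e); crw (eq_sym evP); crw (eq_sym (evr_nat p (xi Y))); crw evX.
have t : (X ◁ evr p (Y ⊗ V)) ∘ assoc X ((Y ⊗ V) ⊗ L) V ∘ ((X ◁ coevr p Y) ▷ V) ∘ assoc' X Y V
    = idm _.
  crw (assoc_nat (idm X) (coevr p Y) (idm V)).
  by crw (assocK X Y V); rewrite -tensmMr evr_coevr tensm1.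
rewrite -[RHS]compm1 -t !compA; congr (_ ∘ _ ∘ _).
rewrite -!compA; congr (_ ∘ (_ ∘ _)).
rewrite -[RHS]compm1; congr (_ ∘ _); coh.
Qed.

End CentralizerTails.

Section ComonoidalTails.
Context {A B : MonCat} {P : Functor A B} (p : ComonoidalOn P).

Definition cm2t (Y1 Y2 : A) (V : B) : Hom (P (Y1 ⊗ Y2) ⊗ V) (P Y1 ⊗ (P Y2 ⊗ V)) :=
  seal (assoc _ _ _ ∘ (cm2 p Y1 Y2 ▷ V)).

Lemma cm2tE (Y1 Y2 : A) (V : B) : cm2t Y1 Y2 V = assoc _ _ _ ∘ (cm2 p Y1 Y2 ▷ V).
Proof. exact: sealE. Qed.

Definition cm0t (V : B) : Hom (P 𝟏 ⊗ V) V := seal (lun V ∘ (cm0 p ▷ V)).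

Lemma cm0tE (V : B) : cm0t V = lun V ∘ (cm0 p ▷ V).
Proof. exact: sealE. Qed.

Lemma cm2t_natV (Y1 Y2 : A) (V V' : B) (h : Hom V V') :
  (P Y1 ◁ (P Y2 ◁ h)) ∘ cm2t Y1 Y2 V = cm2t Y1 Y2 V' ∘ (P (Y1 ⊗ Y2) ◁ h).
Proof.
by rewrite !cm2tE compA -assoc_nat tensm1 -compA -tensm_swap compA.
Qed.

Lemma cm2t_nat (Y1 Y1' Y2 Y2' : A) (V : B) (f : Hom Y1 Y1') (g : Hom Y2 Y2') :
  (fmap P f ⊗m (fmap P g ▷ V)) ∘ cm2t Y1 Y2 V = cm2t Y1' Y2' V ∘ (fmap P (f ⊗m g) ▷ V).
Proof.
by rewrite !cm2tE compA -assoc_nat -!compA -!tensmMl cm2_nat.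
Qed.

Lemma cm2t_assoc (Y1 Y2 Y3 : A) (V : B) :
  cm2t Y1 Y2 (P Y3 ⊗ V) ∘ cm2t (Y1 ⊗ Y2) Y3 V
  = (P Y1 ◁ cm2t Y2 Y3 V) ∘ cm2t Y1 (Y2 ⊗ Y3) V ∘ (fmap P (assoc Y1 Y2 Y3) ▷ V).
Proof.
have e := f_equal (fun k => k ▷ V) (cm_coassoc p Y1 Y2 Y3); rewrite /= !tensmMl in e.
rewrite !cm2tE !tensmMr (rw_tens (P Y3) V (cm2 p Y1 Y2)) !compA.
crw (eq_sym (assoc_nat (idm (P Y1)) (cm2 p Y2 Y3) (idm V))).
crw (eq_sym e).
coh.
Qed.

Lemma cm0t_nat (V V' : B) (h : Hom V V') : h ∘ cm0t V = cm0t V' ∘ (P 𝟏 ◁ h).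
Proof. by rewrite !cm0tE compA -lun_nat -!compA tensm_swap. Qed.

Lemma cm0t_cm2t_l (Y : A) (V : B) :
  cm0t (P Y ⊗ V) ∘ cm2t 𝟏 Y V = fmap P (lun Y) ▷ V.
Proof.
rewrite -(cm_counitl p) !cm0tE !cm2tE (rw_tens (P Y) V (cm0 p)) !tensmMl; coh.
Qed.

Lemma cm0t_cm2t_r (Y : A) (V : B) :
  (P Y ◁ cm0t V) ∘ cm2t Y 𝟏 V = fmap P (run Y) ▷ V.
Proof.
rewrite -(cm_counitr p) !cm0tE !cm2tE !tensmMl !tensmMr (rw_lw (P Y) V (cm0 p)); coh.
Qed.

End ComonoidalTails.

(** * The monad structure of the centralizer of a comonoidal functor *)

Section CentralizerMonad.
Context {A : MonCat} {P : Functor A A} (Z : Centralizer P) (hd : has_left_duals A).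

Local Notation d := (cz_map Z).
Local Notation "'∂'" := (dt Z).

Lemma dt2_ext (X W : A) (f g : Hom (Z (Z X)) W) :
  (forall Y1 Y2, (P Y1 ◁ (P Y2 ◁ f)) ∘ (P Y1 ◁ d (Z X) Y2) ∘ ∂ X Y1 Y2
               = (P Y1 ◁ (P Y2 ◁ g)) ∘ (P Y1 ◁ d (Z X) Y2) ∘ ∂ X Y1 Y2) -> f = g.
Proof.
move=> e; apply: (cz_ext (Z := Z)) => Y2; apply: (dt_ext hd) => Y1.
by rewrite !tensmMr e.
Qed.

Lemma dt2_univ (X W : A) (xi : forall Y1 Y2 : A, Hom (X ⊗ (Y1 ⊗ Y2)) (P Y1 ⊗ (P Y2 ⊗ W))) :
  (forall Y1 Y1' Y2 Y2' (f : Hom Y1 Y1') (g : Hom Y2 Y2'),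
     (fmap P f ⊗m (fmap P g ▷ W)) ∘ xi Y1 Y2 = xi Y1' Y2' ∘ (X ◁ (f ⊗m g))) ->
  exists f : Hom (Z (Z X)) W, forall Y1 Y2,
    (P Y1 ◁ (P Y2 ◁ f)) ∘ (P Y1 ◁ d (Z X) Y2) ∘ ∂ X Y1 Y2 = xi Y1 Y2.
Proof.
move=> nat.
(* The variables are treated one at a time: [Y2] is first a fixed tail while [Y1] is eliminated. *)
have ex Y2 : exists g : Hom (Z X ⊗ Y2) (P Y2 ⊗ W),
    forall Y1, (P Y1 ◁ g) ∘ ∂ X Y1 Y2 = xi Y1 Y2.
  apply: (@dt_univ _ _ Z hd X Y2 (P Y2 ⊗ W) (fun Y1 => xi Y1 Y2)) => Y Y' g.
  by rewrite -(nat _ _ _ _ g (idm Y2)) fmap1 tensm1.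
pose g Y2 := proj1_sig (constructive_indefinite_description _ (ex Y2)).
have eg Y2 : forall Y1, (P Y1 ◁ g Y2) ∘ ∂ X Y1 Y2 = xi Y1 Y2.
  exact: proj2_sig (constructive_indefinite_description _ (ex Y2)).
(* The chosen maps are natural in [Y2] because each is determined by its composites with [∂]; this
   allows [Y2] to be eliminated as well. *)
have gnat Y2 Y2' (k : Hom Y2 Y2') : (fmap P k ▷ W) ∘ g Y2 = g Y2' ∘ (Z X ◁ k).
  apply: (dt_ext hd) => Y1.
  rewrite !tensmMr -?compA eg dt_natV compA eg.
  by rewrite -nat fmap1.
have [f [ef _]] := @cz_univ _ _ Z (Z X) W g gnat.
by exists f => Y1 Y2; rewrite -tensmMr -ef eg.
Qed.

Variable p : ComonoidalOn P.

Local Notation c2 := (cm2t p).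
Local Notation c0 := (cm0t p).

Definition is_cz_mul (X : A) (m : Hom (Z (Z X)) (Z X)) : Prop :=
  forall Y1 Y2 : A,
    (P Y1 ◁ (P Y2 ◁ m)) ∘ (P Y1 ◁ d (Z X) Y2) ∘ ∂ X Y1 Y2
    = c2 Y1 Y2 (Z X) ∘ d X (Y1 ⊗ Y2).

Lemma is_cz_mulE (X : A) (m : Hom (Z (Z X)) (Z X)) :
  is_cz_mul m <-> forall Y1 Y2 : A,
     (idm (P Y1) ⊗m (idm (P Y2) ⊗m m)) ∘ (idm (P Y1) ⊗m d (Z X) Y2)
       ∘ assoc (P Y1) (Z X) Y2 ∘ (d X Y1 ⊗m idm Y2)
     = assoc (P Y1) (P Y2) (Z X) ∘ (cm2 p Y1 Y2 ⊗m idm (Z X))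
         ∘ d X (Y1 ⊗ Y2) ∘ assoc X Y1 Y2.
Proof.
split=> e Y1 Y2.
- have := e Y1 Y2; rewrite dtE !cm2tE => <-.
  by rewrite ?compA -[RHS]compA assoc'K compm1.
- rewrite dtE cm2tE ?compA e.
  by rewrite -compA assocK compm1.
Qed.

Lemma cz_mul_tail (X : A) (m : Hom (Z (Z X)) (Z X)) (Y1 Y2 V : A) : is_cz_mul m ->
  (P Y1 ◁ (P Y2 ◁ (m ▷ V))) ∘ (P Y1 ◁ ∂ (Z X) Y2 V) ∘ ∂ X Y1 (Y2 ⊗ V)
  = c2 Y1 Y2 (Z X ⊗ V) ∘ ∂ X (Y1 ⊗ Y2) V ∘ (X ◁ assoc' Y1 Y2 V).
Proof.
move=> em; have e := f_equal (fun k => k ▷ V) (em Y1 Y2); rewrite /= !tensmMl in e.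
rewrite dt_tens (dtE _ (Z X)) !tensmMr ?compA.
have e0 : (P Y1 ◁ assoc' (Z X) Y2 V) ∘ (P Y1 ◁ assoc (Z X) Y2 V) = idm _.
  by rewrite -tensmMr assoc'K tensm1.
have e1 : (P Y1 ◁ (P Y2 ◁ (m ▷ V))) ∘ (P Y1 ◁ assoc (P Y2) (Z (Z X)) V)
  = (P Y1 ◁ assoc (P Y2) (Z X) V) ∘ (P Y1 ◁ ((P Y2 ◁ m) ▷ V)).
  by rewrite -!tensmMr assoc_nat.
rewrite e1; crw e0.
crw (eq_sym (assoc_nat (idm (P Y1)) (d (Z X) Y2) (idm V))).
crw (eq_sym (assoc_nat (idm (P Y1)) (P Y2 ◁ m) (idm V))).
crw e.
rewrite dtE !cm2tE (rw_tens (Z X) V (cm2 p Y1 Y2)); coh.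
Qed.

Lemma cz_mul_ex (X : A) : exists m : Hom (Z (Z X)) (Z X), is_cz_mul m.
Proof.
apply: (@dt2_univ X (Z X) (fun Y1 Y2 => c2 Y1 Y2 (Z X) ∘ d X (Y1 ⊗ Y2))).
move=> Y1 Y1' Y2 Y2' f g.
by rewrite compA cm2t_nat -compA cz_natr compA.
Qed.

Definition cz_mul (X : A) : Hom (Z (Z X)) (Z X) :=
  proj1_sig (constructive_indefinite_description _ (cz_mul_ex X)).

Lemma cz_mulP (X : A) : is_cz_mul (cz_mul X).
Proof. exact: proj2_sig (constructive_indefinite_description _ (cz_mul_ex X)). Qed.

Definition cz_unit (X : A) : Hom X (Z X) := c0 (Z X) ∘ d X 𝟏 ∘ run' X.

Lemma cz_unit_tail (X V : A) :
  cz_unit X ▷ V = c0 (Z X ⊗ V) ∘ ∂ X 𝟏 V ∘ (X ◁ lun' V).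
Proof.
rewrite /cz_unit dtE !cm0tE (rw_tens (Z X) V (cm0 p)) !tensmMl; coh.
Qed.

Lemma cz_mul_nat (X Y : A) (f : Hom X Y) :
  fmap Z f ∘ cz_mul X = cz_mul Y ∘ fmap Z (fmap Z f).
Proof.
apply: dt2_ext => Y1 Y2; rewrite !tensmMr ?compA.
have e : (P Y1 ◁ (P Y2 ◁ fmap Z (fmap Z f))) ∘ (P Y1 ◁ d (Z X) Y2)
  = (P Y1 ◁ d (Z Y) Y2) ∘ (P Y1 ◁ (fmap Z f ▷ Y2)).
  by rewrite -!tensmMr cz_natl.
crw (cz_mulP X Y1 Y2); crw e; crw (dt_natX Z Y1 Y2 f); crw (cz_mulP Y Y1 Y2).
by rewrite cm2t_natV -?compA cz_natl.
Qed.

Lemma cz_unit_nat (X Y : A) (f : Hom X Y) : fmap Z f ∘ cz_unit X = cz_unit Y ∘ f.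
Proof.
rewrite /cz_unit ?compA cm0t_nat.
by crw (cz_natl Z 𝟏 f); crw (run'_nat f).
Qed.

(** Tested against three successive [∂], both sides become an iterated [P_2] after a single [∂] at
    the product of [Y1], [Y2], [Y3]. Coassociativity of [P] compares the two iterates. *)
Lemma cz_mul_assoc (X : A) : cz_mul X ∘ fmap Z (cz_mul X) = cz_mul X ∘ cz_mul (Z X).
Proof.
apply: (cz_ext (Z := Z)) => Y3; apply: (dt_ext hd) => Y2; apply: (dt_ext hd) => Y1.
(* [B] is kept as a variable so that it passes through the tail equations as one morphism. *)
have [B eB] : {B | B = (P Y3 ◁ cz_mul X) ∘ d (Z X) Y3} by eexists.
have -> : (P Y3 ◁ (cz_mul X ∘ fmap Z (cz_mul X))) ∘ d (Z (Z X)) Y3 = B ∘ (cz_mul X ▷ Y3).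
  by rewrite eB tensmMr -compA cz_natl compA.
have -> : (P Y1 ◁ ((P Y2 ◁ (B ∘ (cz_mul X ▷ Y3))) ∘ ∂ (Z X) Y2 Y3)) ∘ ∂ X Y1 (Y2 ⊗ Y3)
  = c2 Y1 Y2 (P Y3 ⊗ Z X) ∘ c2 (Y1 ⊗ Y2) Y3 (Z X) ∘ d X ((Y1 ⊗ Y2) ⊗ Y3) ∘ (X ◁ assoc' Y1 Y2 Y3).
  rewrite !(tensmMr _ B) !tensmMr ?compA; crw (cz_mul_tail Y1 Y2 Y3 (cz_mulP X)).
  have e := cm2t_natV p Y1 Y2 B; crw e.
  by rewrite eB tensmMr ?compA; crw (cz_mulP X (Y1 ⊗ Y2) Y3).
rewrite !tensmMr ?compA.
have e1 : (P Y1 ◁ (P Y2 ◁ (P Y3 ◁ cz_mul (Z X)))) ∘ (P Y1 ◁ (P Y2 ◁ d (Z (Z X)) Y3))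
    ∘ (P Y1 ◁ ∂ (Z X) Y2 Y3) = (P Y1 ◁ c2 Y2 Y3 (Z (Z X))) ∘ (P Y1 ◁ d (Z X) (Y2 ⊗ Y3)).
  have := f_equal (fun k => P Y1 ◁ k) (cz_mulP (Z X) Y2 Y3).
  by rewrite /= !tensmMr.
have e2 : (P Y1 ◁ (P Y2 ◁ (P Y3 ◁ cz_mul X))) ∘ (P Y1 ◁ c2 Y2 Y3 (Z (Z X)))
  = (P Y1 ◁ c2 Y2 Y3 (Z X)) ∘ (P Y1 ◁ (P (Y2 ⊗ Y3) ◁ cz_mul X)).
  by rewrite -!tensmMr cm2t_natV.
crw e1; crw e2; crw (cz_mulP X Y1 (Y2 ⊗ Y3)).
crw (cm2t_assoc p Y1 Y2 Y3 (Z X)); crw (cz_natr Z X (assoc Y1 Y2 Y3)).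
by rewrite -compA -tensmMr assocK tensm1 compm1.
Qed.

Lemma cz_unitl (X : A) : cz_mul X ∘ cz_unit (Z X) = idm (Z X).
Proof.
apply: (cz_ext (Z := Z)) => Y; rewrite tensm1 comp1m /cz_unit ?compA cm0t_nat !tensmMr ?compA.
have e : (P Y ◁ run' (Z X)) ∘ d X Y = ∂ X Y 𝟏 ∘ (X ◁ run' Y).
  rewrite -[RHS]comp1m -tensm1 -run'K tensmMr ?compA.
  by crw (dt_one Z X Y); rewrite -[RHS]compA -tensmMr runK tensm1 compm1.
crw e; crw (cz_mulP X Y 𝟏); crw (cm0t_cm2t_r p Y (Z X)); crw (cz_natr Z X (run Y)).
by rewrite -compA -tensmMr runK tensm1 compm1.
Qed.

Lemma cz_unitr (X : A) : cz_mul X ∘ fmap Z (cz_unit X) = idm (Z X).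
Proof.
apply: (cz_ext (Z := Z)) => Y; rewrite tensm1 comp1m tensmMr -compA cz_natl compA.
rewrite cz_unit_tail ?compA.
have e := cm0t_nat p ((P Y ◁ cz_mul X) ∘ d (Z X) Y).
crw e; rewrite tensmMr ?compA; crw (cz_mulP X 𝟏 Y).
crw (cm0t_cm2t_l p Y (Z X)); crw (cz_natr Z X (lun Y)).
by rewrite -compA -tensmMr lunK tensm1 compm1.
Qed.

Definition cz_mu : Nat (Z ∘F Z) Z := Build_Nat (F := Z ∘F Z) (G := Z) cz_mul_nat.

Definition cz_eta : Nat (idF A) Z := Build_Nat (F := idF A) (G := Z) cz_unit_nat.

Definition cz_monad : MonadOn Z :=
  {| mu := cz_mu; eta := cz_eta; mu_assoc := cz_mul_assoc;
     mu_etal := cz_unitl; mu_etar := cz_unitr |}.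

Lemma cz_monadP : is_centralizer_monad Z p cz_monad.
Proof.
split=> X; last by rewrite /= /cz_unit !cm0tE ?compA.
by apply/is_cz_mulE; exact: cz_mulP.
Qed.

End CentralizerMonad.

Lemma nat_eq (C D : Category) (F G : Functor C D) (a b : Nat F G) :
  (forall X, a X = b X) -> a = b.
Proof.
case: a b => a ha [b hb] /= e.
have {}e : a = b by exact: functional_extensionality_dep.
by subst b; rewrite (proof_irrelevance _ ha hb).
Qed.

Lemma monadOn_eq (C : Category) (F : Functor C C) (m n : MonadOn F) :
  (forall X, mu m X = mu n X) -> (forall X, eta m X = eta n X) -> m = n.
Proof.
case: m n => m u a b c [m' u' a' b' c'] /= em eu.
have {}em := @nat_eq _ _ (F ∘F F) F m m' em; have {}eu := @nat_eq _ _ (idF C) F u u' eu.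
subst m' u'.
by rewrite (proof_irrelevance _ a a') (proof_irrelevance _ b b') (proof_irrelevance _ c c').
Qed.

Lemma is_centralizer_monad_unique {A : MonCat} {P : Functor A A} (Z : Centralizer P)
    (hd : has_left_duals A) (p : ComonoidalOn P) (m n : MonadOn Z) :
  is_centralizer_monad Z p m -> is_centralizer_monad Z p n -> m = n.
Proof.
move=> [m2 m0] [n2 n0]; apply: monadOn_eq => X; last by rewrite m0 n0.
have em := proj2 (is_cz_mulE p (mu m X)) (m2 X).
have en := proj2 (is_cz_mulE p (mu n X)) (n2 X).
by apply: (dt2_ext hd) => Y1 Y2; rewrite (em Y1 Y2) (en Y1 Y2).
Qed.

(** * The comonoidal structure of the centralizer of a monad *)

Section CentralizerComonoidal.
Context {A : MonCat} {P : Functor A A} (Z : Centralizer P) (hd : has_left_duals A).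
Variable p : MonadOn P.

Local Notation d := (cz_map Z).
Local Notation "'∂'" := (dt Z).

Definition is_cz_cm2 (X1 X2 : A) (f : Hom (Z (X1 ⊗ X2)) (Z X1 ⊗ Z X2)) : Prop :=
  forall Y, (P Y ◁ f) ∘ d (X1 ⊗ X2) Y
    = (mu p Y ▷ (Z X1 ⊗ Z X2)) ∘ ∂ X1 (P Y) (Z X2) ∘ (X1 ◁ d X2 Y) ∘ assoc X1 X2 Y.

Definition is_cz_cm0 (f : Hom (Z 𝟏) 𝟏) : Prop :=
  forall Y, (P Y ◁ f) ∘ d 𝟏 Y = run' (P Y) ∘ eta p Y ∘ lun Y.

Lemma is_cz_cm2E (X1 X2 : A) (f : Hom (Z (X1 ⊗ X2)) (Z X1 ⊗ Z X2)) :
  is_cz_cm2 f <-> forall Y : A,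
     (idm (P Y) ⊗m f) ∘ d (X1 ⊗ X2) Y
     = (mu p Y ⊗m idm (Z X1 ⊗ Z X2)) ∘ assoc (P (P Y)) (Z X1) (Z X2)
         ∘ (d X1 (P Y) ⊗m idm (Z X2)) ∘ assoc' X1 (P Y) (Z X2)
         ∘ (idm X1 ⊗m d X2 Y) ∘ assoc X1 X2 Y.
Proof. by split=> e Y; have := e Y; rewrite dtE ?compA. Qed.

Lemma is_cz_cm0E (f : Hom (Z 𝟏) 𝟏) :
  is_cz_cm0 f <-> forall Y : A, run (P Y) ∘ (idm (P Y) ⊗m f) ∘ d 𝟏 Y ∘ lun' Y = eta p Y.
Proof.
split=> e Y.
- crw (e Y); crw (runK (P Y)); by rewrite -compA lunK compm1.
- by rewrite -e ?compA run'K comp1m -compA lun'K compm1.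
Qed.

Lemma cz_cm2_ex (X1 X2 : A) : exists f : Hom (Z (X1 ⊗ X2)) (Z X1 ⊗ Z X2), is_cz_cm2 f.
Proof.
pose xi Y := (mu p Y ▷ (Z X1 ⊗ Z X2)) ∘ ∂ X1 (P Y) (Z X2) ∘ (X1 ◁ d X2 Y) ∘ assoc X1 X2 Y.
have nat Y Y' (k : Hom Y Y') :
    (fmap P k ▷ (Z X1 ⊗ Z X2)) ∘ xi Y = xi Y' ∘ ((X1 ⊗ X2) ◁ k).
  rewrite /xi ?compA -tensmMl mu_nat tensmMl.
  crw (dt_natY Z X1 (Z X2) (fmap P k)).
  rewrite -(tensm1 X1 X2) -[RHS]compA assoc_nat ?compA.
  have e := f_equal (fun k => X1 ◁ k) (cz_natr Z X2 k); rewrite /= !tensmMr in e.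
  by crw e.
have [r [er _]] := @cz_univ _ _ Z (X1 ⊗ X2) _ xi nat.
by exists r => Y; rewrite -er.
Qed.

Lemma cz_cm0_ex : exists f : Hom (Z 𝟏) 𝟏, is_cz_cm0 f.
Proof.
pose xi Y := run' (P Y) ∘ eta p Y ∘ lun Y.
have nat Y Y' (k : Hom Y Y') : (fmap P k ▷ 𝟏) ∘ xi Y = xi Y' ∘ (𝟏 ◁ k).
  by rewrite /xi ?compA -run'_nat; crw (eta_nat p k); crw (lun_nat k).
have [r [er _]] := @cz_univ _ _ Z 𝟏 _ xi nat.
by exists r => Y; rewrite -er.
Qed.

Definition cz_cm2 (X1 X2 : A) : Hom (Z (X1 ⊗ X2)) (Z X1 ⊗ Z X2) :=
  proj1_sig (constructive_indefinite_description _ (cz_cm2_ex X1 X2)).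

Lemma cz_cm2P (X1 X2 : A) : is_cz_cm2 (cz_cm2 X1 X2).
Proof. exact: proj2_sig (constructive_indefinite_description _ (cz_cm2_ex X1 X2)). Qed.

Definition cz_cm0 : Hom (Z 𝟏) 𝟏 :=
  proj1_sig (constructive_indefinite_description _ cz_cm0_ex).

Lemma cz_cm0P : is_cz_cm0 cz_cm0.
Proof. exact: proj2_sig (constructive_indefinite_description _ cz_cm0_ex). Qed.

Lemma cz_cm2_tail (X1 X2 Y V : A) :
  (P Y ◁ (assoc _ _ _ ∘ (cz_cm2 X1 X2 ▷ V))) ∘ ∂ (X1 ⊗ X2) Y V
  = (mu p Y ▷ (Z X1 ⊗ (Z X2 ⊗ V))) ∘ ∂ X1 (P Y) (Z X2 ⊗ V) ∘ (X1 ◁ ∂ X2 Y V)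
    ∘ assoc X1 X2 (Y ⊗ V).
Proof.
have e := f_equal (fun k => k ▷ V) (cz_cm2P X1 X2 Y); rewrite /= !tensmMl in e.
rewrite dt_tens !(dtE _ _ Y) tensmMr ?compA.
crw (eq_sym (assoc_nat (idm (P Y)) (cz_cm2 X1 X2) (idm V))).
crw e; rewrite (rw_tens (Z X1) (Z X2 ⊗ V) (mu p Y)) (rw_tens (Z X2) V (mu p Y ▷ Z X1)).
rewrite (rw_tens (Z X1) (Z X2) (mu p Y)) (rw_lw X1 V (d X2 Y)); coh.
Qed.

Lemma cz_cm0_tail (Y V : A) :
  (P Y ◁ (lun V ∘ (cz_cm0 ▷ V))) ∘ ∂ 𝟏 Y V = (eta p Y ▷ V) ∘ lun (Y ⊗ V).
Proof.
have e := f_equal (fun k => k ▷ V) (cz_cm0P Y); rewrite /= !tensmMl in e.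
rewrite dtE tensmMr ?compA.
crw (eq_sym (assoc_nat (idm (P Y)) cz_cm0 (idm V))).
crw e; coh.
Qed.

Lemma cz_cm2_nat (X X' Y Y' : A) (f : Hom X X') (g : Hom Y Y') :
  (fmap Z f ⊗m fmap Z g) ∘ cz_cm2 X Y = cz_cm2 X' Y' ∘ fmap Z (f ⊗m g).
Proof.
apply: (cz_ext (Z := Z)) => V; rewrite !tensmMr.
crw (cz_cm2P X Y V); crw (cz_natl Z V (f ⊗m g)); crw (cz_cm2P X' Y' V).
crw (eq_sym (tensm_swap (mu p V) (fmap Z f ⊗m fmap Z g))).
rewrite -(tensm_lr (fmap Z f) (fmap Z g)) tensmMr ?compA.
crw (dt_natV Z X (P V) (fmap Z g)); crw (dt_natX Z (P V) (Z Y') f).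
rewrite -[RHS]compA assoc_nat ?compA -(tensm_rl f (g ▷ V)) ?compA.
have e := f_equal (fun k => X' ◁ k) (cz_natl Z V g); rewrite /= !tensmMr in e.
crw (eq_sym e).
by crw (tensm_swap f (P V ◁ fmap Z g)); crw (tensm_swap f (d Y V)).
Qed.

Lemma cz_cm2_assoc (X1 X2 X3 : A) :
  assoc _ _ _ ∘ (cz_cm2 X1 X2 ▷ Z X3) ∘ cz_cm2 (X1 ⊗ X2) X3
  = (Z X1 ◁ cz_cm2 X2 X3) ∘ cz_cm2 X1 (X2 ⊗ X3) ∘ fmap Z (assoc X1 X2 X3).
Proof.
apply: (cz_ext (Z := Z)) => Y.
rewrite (tensmMr _ _ (cz_cm2 (X1 ⊗ X2) X3)) -compA (cz_cm2P (X1 ⊗ X2) X3 Y) ?compA.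
crw (eq_sym (tensm_swap (mu p Y) (assoc _ _ _ ∘ (cz_cm2 X1 X2 ▷ Z X3)))).
crw (cz_cm2_tail X1 X2 (P Y) (Z X3)).
rewrite (tensmMr _ _ (fmap Z _)) -[RHS]compA cz_natl.
rewrite (tensmMr _ _ (cz_cm2 X1 _)) ?compA; crw (cz_cm2P X1 (X2 ⊗ X3) Y).
crw (eq_sym (tensm_swap (mu p Y) (Z X1 ◁ cz_cm2 X2 X3))).
crw (dt_natV Z X1 (P Y) (cz_cm2 X2 X3)).
have e := f_equal (fun k => X1 ◁ k) (cz_cm2P X2 X3 Y); rewrite /= !tensmMr in e.
crw e.
(* Both sides now apply [∂] for [X3], [X2] and [X1] in turn and then multiply twice in [P]; they
   differ by associativity of [μ]. *)
crw (eq_sym (dt_natY Z X1 (Z X2 ⊗ Z X3) (mu p Y))).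
rewrite -!tensmMl (mu_assoc p) ?compA.
rewrite !(lw_tens X1 X2 (d X3 Y)); coh.
Qed.

Lemma cz_counitl (X : A) : lun _ ∘ (cz_cm0 ▷ Z X) ∘ cz_cm2 𝟏 X = fmap Z (lun X).
Proof.
apply: (cz_ext (Z := Z)) => Y.
rewrite (tensmMr _ _ (cz_cm2 _ _)) -compA (cz_cm2P 𝟏 X Y) ?compA.
crw (eq_sym (tensm_swap (mu p Y) (lun _ ∘ (cz_cm0 ▷ Z X)))).
crw (cz_cm0_tail (P Y) (Z X)); rewrite -tensmMl (mu_etal p) tensm1 comp1m.
by rewrite lun_nat cz_natl -compA; congr (_ ∘ _); coh.
Qed.

Lemma cz_counitr (X : A) : run _ ∘ (Z X ◁ cz_cm0) ∘ cz_cm2 X 𝟏 = fmap Z (run X).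
Proof.
apply: (cz_ext (Z := Z)) => Y.
rewrite !tensmMr -compA (cz_cm2P X 𝟏 Y) ?compA.
rewrite -tensmMr; crw (eq_sym (tensm_swap (mu p Y) (run _ ∘ (Z X ◁ cz_cm0)))).
rewrite tensmMr ?compA; crw (dt_natV Z X (P Y) cz_cm0).
crw (dt_one Z X (P Y)).
have e := f_equal (fun k => X ◁ k) (cz_cm0P Y); rewrite /= !tensmMr in e.
crw e; rewrite -(compA _ (X ◁ run _) (X ◁ run' _)) -tensmMr runK tensm1 compm1.
crw (eq_sym (cz_natr Z X (eta p Y))); rewrite -tensmMl (mu_etar p) tensm1 comp1m.
by rewrite cz_natl -compA; congr (_ ∘ _); coh.
Qed.

Definition cz_comon : ComonoidalOn Z :=
  {| cm2 := cz_cm2; cm0 := cz_cm0; cm2_nat := cz_cm2_nat; cm_coassoc := cz_cm2_assoc;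
     cm_counitl := cz_counitl; cm_counitr := cz_counitr |}.

Lemma cz_comonP : is_centralizer_comon Z p cz_comon.
Proof.
split=> [X1 X2|]; first by apply/is_cz_cm2E; exact: cz_cm2P.
by apply/is_cz_cm0E; exact: cz_cm0P.
Qed.

End CentralizerComonoidal.

(** * Compatibility of the two structures when the functor is a bimonad *)

Section CentralizerBimonad.
Context {A : MonCat} {P : Functor A A} (Z : Centralizer P) (hd : has_left_duals A).
Variable p : BimonadOn P.

Local Notation d := (cz_map Z).
Local Notation "'∂'" := (dt Z).
Local Notation m := (cz_mul Z hd p).
Local Notation c2 := (cm2t p).
Local Notation c0 := (cm0t p).
Local Notation z2 := (cz_cm2 Z p).
Local Notation z0 := (cz_cm0 Z p).

Lemma cm2t_mu (Y1 Y2 V : A) :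
  c2 Y1 Y2 V ∘ (mu p (Y1 ⊗ Y2) ▷ V)
  = (mu p Y1 ⊗m (mu p Y2 ▷ V)) ∘ c2 (P Y1) (P Y2) V ∘ (fmap P (cm2 p Y1 Y2) ▷ V).
Proof.
rewrite !cm2tE -!compA -!tensmMl mu_cm2 !tensmMl ?compA.
by crw (assoc_nat (mu p Y1) (mu p Y2) (idm V)).
Qed.

Lemma cz_mul_comon2 (X1 X2 : A) :
  z2 X1 X2 ∘ m (X1 ⊗ X2)
  = (m X1 ⊗m m X2) ∘ (z2 (Z X1) (Z X2) ∘ fmap Z (z2 X1 X2)).
Proof.
apply: (dt2_ext hd) => Y1 Y2.
(* The common value: [X2] passes [Y1] and [Y2], then [X1] passes [P Y1] and [P Y2], and finally all
   products are taken. The left side reaches it by compatibility of [μ] with [P_2], the right side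
   by unfolding [z2] twice. *)
transitivity ((mu p Y1 ⊗m (mu p Y2 ▷ (Z X1 ⊗ Z X2)))
  ∘ (P (P Y1) ◁ (P (P Y2) ◁ (m X1 ⊗m m X2)))
  ∘ (P (P Y1) ◁ ∂ (Z X1) (P Y2) (Z (Z X2))) ∘ ∂ X1 (P Y1) (P Y2 ⊗ Z (Z X2))
  ∘ (X1 ◁ (P Y1 ◁ d (Z X2) Y2)) ∘ (X1 ◁ ∂ X2 Y1 Y2) ∘ assoc X1 X2 (Y1 ⊗ Y2)).
- rewrite !tensmMr; crw (cz_mulP Z hd p (X1 ⊗ X2) Y1 Y2).
  crw (cm2t_natV p Y1 Y2 (z2 X1 X2)).
  crw (cz_cm2P Z p X1 X2 (Y1 ⊗ Y2)); crw (cm2t_mu Y1 Y2 (Z X1 ⊗ Z X2)).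
  crw (dt_natY Z X1 (Z X2) (cm2 p Y1 Y2)).
  have e : (cm2 p Y1 Y2 ▷ Z X2) ∘ d X2 (Y1 ⊗ Y2)
    = ((P Y1 ⊗ P Y2) ◁ m X2) ∘ assoc' _ _ _ ∘ (P Y1 ◁ d (Z X2) Y2) ∘ ∂ X2 Y1 Y2.
    have e1 := cz_mulP Z hd p X2 Y1 Y2; rewrite cm2tE in e1.
    rewrite -[LHS]comp1m -(assoc'K (P Y1) (P Y2) (Z X2)) ?compA.
    by crw (eq_sym e1); rewrite assoc'_nat tensm1.
  have {}e := f_equal (fun k => X1 ◁ k) e; rewrite /= !tensmMr in e.
  crw e; crw (eq_sym (dt_natV Z X1 (P Y1 ⊗ P Y2) (m X2))).
  crw (eq_sym (cm2t_natV p (P Y1) (P Y2) (Z X1 ◁ m X2))).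
  crw (eq_sym (cz_mul_tail (P Y1) (P Y2) (Z (Z X2)) (cz_mulP Z hd p X1))).
  by rewrite -(tensm_rl (m X1) (m X2)) !tensmMr ?compA.
- rewrite ![in RHS]tensmMr ?compA.
  have e : (P Y2 ◁ z2 (Z X1) (Z X2)) ∘ (P Y2 ◁ fmap Z (z2 X1 X2)) ∘ d (Z (X1 ⊗ X2)) Y2
    = (mu p Y2 ▷ _) ∘ ∂ (Z X1) (P Y2) (Z (Z X2)) ∘ (Z X1 ◁ d (Z X2) Y2)
      ∘ (assoc (Z X1) (Z X2) Y2 ∘ (z2 X1 X2 ▷ Y2)).
    by crw (cz_natl Z Y2 (z2 X1 X2)); crw (cz_cm2P Z p (Z X1) (Z X2) Y2).
  have {}e := f_equal (fun k => P Y1 ◁ k) e.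
  rewrite /= !(tensmMr _ (_ ∘ _)) (tensmMr _ (_ ▷ _)) (tensmMr _ (P Y2 ◁ _)) in e.
  crw e; crw (cz_cm2_tail Z p X1 X2 Y1 Y2).
  crw (eq_sym (tensm_swap (mu p Y1) (Z X1 ◁ d (Z X2) Y2))).
  crw (eq_sym (tensm_swap (mu p Y1) (∂ (Z X1) (P Y2) (Z (Z X2))))).
  crw (dt_natV Z X1 (P Y1) (d (Z X2) Y2)).
  congr (_ ∘ _ ∘ _ ∘ _ ∘ _ ∘ _).
  by rewrite -!tensmM ?comp1m ?compm1.
Qed.

Lemma cz_mul_comon0 : z0 ∘ m 𝟏 = z0 ∘ fmap Z z0.
Proof.
apply: (dt2_ext hd) => Y1 Y2.
(* Both sides insert the unit of [P] at [Y1] and at [Y2]; for the left side this is compatibility of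
   [η] with [P_2]. *)
transitivity ((P Y1 ◁ run' (P Y2)) ∘ (eta p Y1 ⊗m eta p Y2) ∘ lun (Y1 ⊗ Y2)).
- rewrite !tensmMr; crw (cz_mulP Z hd p 𝟏 Y1 Y2).
  crw (cm2t_natV p Y1 Y2 z0); crw (cz_cm0P Z p (Y1 ⊗ Y2)).
  have e : c2 Y1 Y2 𝟏 ∘ run' (P (Y1 ⊗ Y2)) = (P Y1 ◁ run' (P Y2)) ∘ cm2 p Y1 Y2.
    rewrite cm2tE (rw_one (cm2 p Y1 Y2)); coh.
  by crw e; crw (eta_cm2 p Y1 Y2).
- rewrite ![in RHS]tensmMr ?compA.
  have e : (P Y2 ◁ z0) ∘ (P Y2 ◁ fmap Z z0) ∘ d (Z 𝟏) Y2
    = run' (P Y2) ∘ eta p Y2 ∘ (lun Y2 ∘ (z0 ▷ Y2)).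
    by crw (cz_natl Z Y2 z0); crw (cz_cm0P Z p Y2).
  have {}e := f_equal (fun k => P Y1 ◁ k) e.
  rewrite /= !(tensmMr _ (_ ∘ _)) (tensmMr _ (run' _)) (tensmMr _ (P Y2 ◁ _)) in e.
  crw e; crw (cz_cm0_tail Z p Y1 Y2).
  by crw (tensm_rl (eta p Y1) (eta p Y2)).
Qed.

Lemma cm0t_mu (V : A) : c0 V ∘ (mu p 𝟏 ▷ V) = c0 V ∘ (fmap P (cm0 p) ▷ V).
Proof. by rewrite !cm0tE -!compA -!tensmMl mu_cm0. Qed.

Lemma cz_unit_comon2 (X1 X2 : A) :
  z2 X1 X2 ∘ cz_unit Z p (X1 ⊗ X2) = cz_unit Z p X1 ⊗m cz_unit Z p X2.
Proof.
rewrite -(tensm_lr (cz_unit Z p X1)) cz_unit_tail /cz_unit tensmMr ?compA cm0t_nat.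
(* Compatibility of [μ] with [P_0] replaces the product by two counits, one for each unit
   [X1 → Z X1] and [X2 → Z X2]. *)
crw (cz_cm2P Z p X1 X2 𝟏); crw (cm0t_mu (Z X1 ⊗ Z X2)).
crw (dt_natY Z X1 (Z X2) (cm0 p)).
have -> : cm0 p ▷ Z X2 = lun' (Z X2) ∘ c0 (Z X2).
  by rewrite cm0tE compA lun'K comp1m.
rewrite !tensmMr ?compA -[LHS]compA; congr (_ ∘ _); coh.
Qed.

Lemma cz_unit_comon0 : z0 ∘ cz_unit Z p 𝟏 = idm 𝟏.
Proof.
rewrite /cz_unit ?compA cm0t_nat; crw (cz_cm0P Z p 𝟏).
rewrite cm0tE; crw (eq_sym (run'_nat (cm0 p))); crw (eta_cm0 p); coh.
Qed.

Lemma cz_mu_comon :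
  comonoidal_nat (comp_comon (cz_comon Z p) (cz_comon Z p)) (cz_comon Z p)
    (mu (cz_monad Z hd p)).
Proof. by split=> [X Y|]; [exact: cz_mul_comon2|exact: cz_mul_comon0]. Qed.

Lemma cz_eta_comon :
  comonoidal_nat (id_comon A) (cz_comon Z p) (eta (cz_monad Z hd p)).
Proof.
split=> [X Y|]; last exact: cz_unit_comon0.
by rewrite compm1; exact: cz_unit_comon2.
Qed.

Definition cz_bimonad : BimonadOn Z :=
  {| bo_monad := cz_monad Z hd p; bo_comon := cz_comon Z p;
     mu_comon := cz_mu_comon; eta_comon := cz_eta_comon |}.

Lemma cz_bimonadP : is_centralizer_bimonad Z p cz_bimonad.
Proof. by split; [exact: cz_monadP|exact: cz_comonP]. Qed.

End CentralizerBimonad.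

Lemma comonoidalOn_eq {A B : MonCat} (F : Functor A B) (c c' : ComonoidalOn F) :
  (forall X Y, cm2 c X Y = cm2 c' X Y) -> cm0 c = cm0 c' -> c = c'.
Proof.
case: c c' => f f0 a1 a2 a3 a4 [f' f0' b1 b2 b3 b4] /= e e0; subst f0'.
have {}e : f = f'.
  by apply: functional_extensionality_dep => X; apply: functional_extensionality_dep.
subst f'; rewrite (proof_irrelevance _ a1 b1) (proof_irrelevance _ a2 b2).
by rewrite (proof_irrelevance _ a3 b3) (proof_irrelevance _ a4 b4).
Qed.

Lemma bimonadOn_eq {A : MonCat} (F : Functor A A) (b c : BimonadOn F) :
  bo_monad b = bo_monad c -> bo_comon b = bo_comon c -> b = c.
Proof.
case: b c => m k u v [m' k' u' v'] /= em ek; subst m' k'.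
by rewrite (proof_irrelevance _ u u') (proof_irrelevance _ v v').
Qed.

Lemma is_centralizer_comon_unique {A : MonCat} {P : Functor A A} (Z : Centralizer P)
    (p : MonadOn P) (c c' : ComonoidalOn Z) :
  is_centralizer_comon Z p c -> is_centralizer_comon Z p c' -> c = c'.
Proof.
move=> [c2 c0] [c2' c0']; apply: comonoidalOn_eq => [X Y|].
- by apply: (cz_ext (Z := Z)) => V; rewrite c2 c2'.
- apply: (cz_ext (Z := Z)) => V.
  by rewrite (proj2 (is_cz_cm0E p _) c0 V) (proj2 (is_cz_cm0E p _) c0' V).
Qed.

Lemma is_centralizer_bimonad_unique {A : MonCat} {P : Functor A A} (Z : Centralizer P)
    (hd : has_left_duals A) (p : BimonadOn P) (b c : BimonadOn Z) :
  is_centralizer_bimonad Z p b -> is_centralizer_bimonad Z p c -> b = c.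
Proof.
move=> [bm bc] [cm cc]; apply: bimonadOn_eq.
- exact: (is_centralizer_monad_unique hd bm cm).
- exact: (is_centralizer_comon_unique bc cc).
Qed.

(** * Lifting the centralizer to modules *)

Section LiftCentralizer.
Context {C : AutCat} {T : HopfMonad C} {Q : Functor (ModMon T) (ModMon T)}.
Variable Z : Centralizer (cross Q).

Local Notation F := (freeM T).
Local Notation d := (cz_map Z).

(* The map [∂~_{M,N}] of the informal statement. *)
Definition ld (M N : ModMon T) : Hom (car M ⊗ car N) (car (Q N) ⊗ Z (car M)) :=
  seal ((lin (fmap Q (counitM N)) ▷ Z (car M)) ∘ d (car M) (car N)).

Lemma ldE (M N : ModMon T) :
  ld M N = (lin (fmap Q (counitM N)) ▷ Z (car M)) ∘ d (car M) (car N).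
Proof. exact: sealE. Qed.

Lemma cross_natr (X Y Y' : C) (k : Hom Y Y') :
  (lin (fmap Q (fmap F k)) ▷ Z X) ∘ d X Y = d X Y' ∘ (X ◁ k).
Proof. exact: (cz_natr Z X k). Qed.

Lemma cross_natl (X X' Y : C) (f : Hom X X') :
  (car (Q (F Y)) ◁ fmap Z f) ∘ d X Y = d X' Y ∘ (f ▷ Y).
Proof. exact: (cz_natl Z Y f). Qed.

Lemma ld_natr (M N N' : ModMon T) (g : Hom N N') :
  (lin (fmap Q g) ▷ Z (car M)) ∘ ld M N = ld M N' ∘ (car M ◁ lin g).
Proof.
rewrite !ldE -[RHS]compA -cross_natr !compA -!tensmMl -!lin_comp -!fmapM.
by rewrite counitM_nat.
Qed.

Lemma ld_natl (M M' N : ModMon T) (f : Hom M M') :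
  (car (Q N) ◁ fmap Z (lin f)) ∘ ld M N = ld M' N ∘ (lin f ▷ car N).
Proof.
rewrite !ldE compA -tensm_swap -!compA; congr (_ ∘ _).
exact: cross_natl.
Qed.

(** A triangle identity of the free-forgetful adjunction. It recovers [∂] from its lift, so
    statements about [∂] can be tested on free modules. *)
Lemma ld_free (M : ModMon T) (Y : C) : ld M (F Y) ∘ (car M ◁ η T Y) = d (car M) Y.
Proof.
rewrite ldE -compA -cross_natr compA -tensmMl -lin_comp -fmapM.
have -> : counitM (F Y) ∘ fmap F (η T Y) = idm (F Y).
  by apply: lin_eq; exact: (mu_etar (mon_on T)).
by rewrite fmap1 lin_idm tensm1 comp1m.
Qed.

Lemma ld_ext (M : ModMon T) (W : C) (f g : Hom (Z (car M)) W) :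
  (forall N, (car (Q N) ◁ f) ∘ ld M N = (car (Q N) ◁ g) ∘ ld M N) -> f = g.
Proof.
move=> e; apply: (cz_ext (Z := Z)) => Y; rewrite -ld_free !compA.
by have := e (F Y) => /= ->.
Qed.

Definition linear (M N : ModMon T) (f : Hom (car M) (car N)) : Prop :=
  f ∘ act M = act N ∘ fmap T f.

(** Module structures on an object correspond to coalgebra structures for the comonad [W ↦ K W],
    right adjoint to [T]. The proof constructs a coaction and reads the action off it. *)
Lemma lift_action_exists (M : ModMon T) :
  exists (r : Hom (T (Z (car M))) (Z (car M)))
    (rm : r ∘ fmap T r = r ∘ μ T (Z (car M))) (re : r ∘ η T (Z (car M)) = idm _),
  let R : ModMon T := Build_Module rm re in
  forall N : ModMon T, linear (M := M ⊗ N) (N := Q N ⊗ R) (ld M N).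
Proof.
have [K [e [[ex inj] ce]]] := cofree_tens_exists (T := T) (Z (car M)).
(* The comonad applied twice to [Z M], where coassociativity of the coaction is expressed. *)
have [K2 [e2 [[ex2 inj2] ce2]]] := cofree_tens_exists (T := T) (car K).
have hex N := (proj1 (ce (Q N))) (M ⊗ N) (ld M N).
pose h N := proj1_sig (constructive_indefinite_description _ (hex N)).
have eh N : (car (Q N) ◁ e) ∘ lin (h N) = ld M N.
  exact: proj2_sig (constructive_indefinite_description _ (hex N)).
clearbody h.
have hnat N N' (g : Hom N N') : (fmap Q g ▷ K) ∘ h N = h N' ∘ (M ◁ g).
  apply: (proj2 (ce (Q N'))); rewrite !lin_comp !lin_tens !lin_idm !compA eh.
  by rewrite -tensm_swap -compA eh ld_natr.
pose xi Y := lin (h (F Y)) ∘ (car M ◁ η T Y).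
have xinat Y Y' (k : Hom Y Y') :
    (fmap (cross Q) k ▷ car K) ∘ xi Y = xi Y' ∘ (car M ◁ k).
  have := f_equal lin (hnat _ _ (fmap F k)); rewrite !lin_comp !lin_tens !lin_idm => E.
  rewrite /xi compA; rewrite [X in X ∘ _ = _]E -!compA -!tensmMr; congr (_ ∘ (_ ◁ _)).
  exact: (eta_nat (mon_on T)).
have [κ [κP _]] := @cz_univ _ _ Z (car M) (car K) xi xinat.
(* The equation holds on free modules by the choice of [κ]; naturality of [h] along the action
   [F N → N], which [η] splits, extends it to every module. *)
have κh N : (car (Q N) ◁ κ) ∘ ld M N = lin (h N).
  have E := f_equal lin (hnat _ _ (counitM N)); rewrite !lin_comp !lin_tens !lin_idm in E.
  rewrite ldE compA -tensm_swap -compA -[_ ∘ d _ _]κP /xi compA [X in X ∘ _ = _]E.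
  by rewrite -compA -tensmMr (act_eta N) tensm1 compm1.
have eκ : e ∘ κ = idm _.
  apply: ld_ext => N; rewrite tensmMr -compA κh eh.
  by rewrite tensm1 comp1m.
(* [δ] is the comultiplication of the comonad at [Z M], and [Kκ] is the cofree functor applied to
   [κ]. *)
have [δ eδ] := ex2 K (idm (car K)).
have [Kκ eK] := ex2 K (κ ∘ e).
have coass : lin Kκ ∘ κ = lin δ ∘ κ.
  apply: ld_ext => N; rewrite !tensmMr -!compA κh.
  suff E : (Q N ◁ Kκ) ∘ h N = (Q N ◁ δ) ∘ h N by exact: (f_equal lin E).
  apply: (proj2 (ce2 (Q N))); rewrite !lin_comp !lin_tens !lin_idm !compA -!tensmMr.
  by rewrite eK eδ tensm1 comp1m tensmMr -compA eh κh.
pose r := e ∘ act K ∘ fmap T κ.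
(* Coassociativity makes [κ] compatible with the actions [r] and [act K], so associativity of [r]
   reduces to that of [act K]. *)
have κr : κ ∘ r = act K ∘ fmap T κ.
  rewrite /r !compA -eK -(compA e2) (lin_act Kκ) -!compA -fmapM coass fmapM !compA.
  by rewrite -(compA e2) -(lin_act δ) compA eδ comp1m.
have rm : r ∘ fmap T r = r ∘ μ T (Z (car M)).
  rewrite {1}/r -compA -fmapM κr fmapM compA -(compA e) act_mu.
  rewrite /r -!compA; congr (_ ∘ (_ ∘ _)); symmetry; exact: (mu_nat (mon_on T)).
have re : r ∘ η T (Z (car M)) = idm _.
  rewrite /r -compA [fmap T κ ∘ _](eta_nat (mon_on T)) compA -(compA e) act_eta compm1.
  exact: eκ.
exists r, rm, re => R N; rewrite /linear.
have E := lin_act (h N); rewrite -{1}eh -compA E -κh fmapM /=.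
rewrite !compA; crw (eq_sym (cm2_natr (bi_comon T) (car (Q N)) κ)).
congr (_ ∘ _ ∘ _).
by rewrite /r -!tensmM ?comp1m ?compm1.
Qed.

Definition lift_act (M : ModMon T) : Hom (T (Z (car M))) (Z (car M)) :=
  proj1_sig (constructive_indefinite_description _ (lift_action_exists M)).

Lemma lift_actP (M : ModMon T) :
  exists (rm : lift_act M ∘ fmap T (lift_act M) = lift_act M ∘ μ T (Z (car M)))
    (re : lift_act M ∘ η T (Z (car M)) = idm _),
  forall N, linear (M := M ⊗ N) (N := Q N ⊗ (Build_Module rm re : ModMon T)) (ld M N).
Proof. exact: proj2_sig (constructive_indefinite_description _ (lift_action_exists M)). Qed.

Lemma lift_act_mu (M : ModMon T) :
  lift_act M ∘ fmap T (lift_act M) = lift_act M ∘ μ T (Z (car M)).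
Proof. by have [rm _] := lift_actP M; exact: rm. Qed.

Lemma lift_act_eta (M : ModMon T) : lift_act M ∘ η T (Z (car M)) = idm _.
Proof. by have [rm [re _]] := lift_actP M; exact: re. Qed.

Definition lift_mod (M : ModMon T) : ModMon T :=
  Build_Module (lift_act_mu M) (lift_act_eta M).

Lemma ld_linear (M N : ModMon T) :
  linear (M := M ⊗ N) (N := Q N ⊗ lift_mod M) (ld M N).
Proof. by have [rm [re lin_ld]] := lift_actP M; exact: lin_ld. Qed.

(* Linearity of [f] is tested after composition with the unit [w : W → K] of
   the cofree module on [W], which is a split monomorphism. *)
Lemma lift_linear (M W : ModMon T) (f : Hom (Z (car M)) (car W)) :
  (forall N, linear (M := M ⊗ N) (N := Q N ⊗ W) ((car (Q N) ◁ f) ∘ ld M N)) ->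
  linear (M := lift_mod M) (N := W) f.
Proof.
move=> lf; have [K [e [[ex inj] ce]]] := cofree_tens_exists (T := T) (car W).
have [w ew] := ex W (idm (car W)).
have [k ek] := ex (lift_mod M) f.
have kw : lin k = lin w ∘ f.
  apply: ld_ext => N.
  pose a : @Hom (ModMon T) (M ⊗ N) (Q N ⊗ lift_mod M) :=
    @Build_LinHom C T (M ⊗ N) (Q N ⊗ lift_mod M) _ (ld_linear M N).
  pose b : @Hom (ModMon T) (M ⊗ N) (Q N ⊗ W) :=
    @Build_LinHom C T (M ⊗ N) (Q N ⊗ W) _ (lf N).
  rewrite tensmMr -compA.
  suff E : (Q N ◁ k) ∘ a = (Q N ◁ w) ∘ b by exact: (f_equal lin E).
  apply: (proj2 (ce (Q N))); rewrite !lin_comp !lin_tens !lin_idm !compA -!tensmMr.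
  by rewrite ek ew comp1m.
rewrite /linear -[X in X ∘ _]comp1m -ew -(compA e) -kw -(compA e) (lin_act k) kw fmapM.
by rewrite (compA (act K)) -(lin_act w) !compA ew comp1m.
Qed.

Lemma fmap_linear (M M' : ModMon T) (f : Hom M M') :
  linear (M := lift_mod M) (N := lift_mod M') (fmap Z (lin f)).
Proof.
apply: lift_linear => N; rewrite ld_natl.
pose a : @Hom (ModMon T) (M' ⊗ N) (Q N ⊗ lift_mod M') :=
  @Build_LinHom C T (M' ⊗ N) (Q N ⊗ lift_mod M') _ (ld_linear M' N).
exact: (lin_act (a ∘ (f ▷ N))).
Qed.

Definition lift_fun : Functor (ModMon T) (ModMon T).
Proof.
unshelve refine (@Build_Functor (ModMon T) (ModMon T) lift_mod
  (fun M M' f => @Build_LinHom C T (lift_mod M) (lift_mod M') _ (fmap_linear f)) _ _).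
- by move=> M; apply: lin_eq; rewrite /= fmap1.
- by move=> M M' M'' g f; apply: lin_eq; rewrite /= fmapM.
Defined.

Definition lift_map (M N : ModMon T) : Hom (M ⊗ N) (Q N ⊗ lift_fun M) :=
  @Build_LinHom C T (M ⊗ N) (Q N ⊗ lift_mod M) _ (ld_linear M N).

Definition lift_cz : Centralizer Q.
Proof.
unshelve refine (@Build_Centralizer (ModMon T) Q lift_fun lift_map _ _).
- move=> M M' N N' f g; apply: lin_eq.
  change ((lin (fmap Q g) ⊗m fmap Z (lin f)) ∘ ld M N = ld M' N' ∘ (lin f ⊗m lin g)).
  rewrite -(tensm_rl (lin (fmap Q g))) -(tensm_lr (lin f)) -compA ld_natr compA.
  by rewrite ld_natl compA.
- move=> M W xi nat.
  (* As in the construction of [κ], the family is restricted to free modules along [η], and the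
     resulting equation is extended to all modules through their actions. *)
  pose x Y := lin (xi (F Y)) ∘ (car M ◁ η T Y).
  have xnat Y Y' (k : Hom Y Y') : (fmap (cross Q) k ▷ car W) ∘ x Y = x Y' ∘ (car M ◁ k).
    have := f_equal lin (nat _ _ (fmap F k)); rewrite !lin_comp !lin_tens !lin_idm => E.
    rewrite /x compA; rewrite [X in X ∘ _ = _]E -!compA -!tensmMr; congr (_ ∘ (_ ◁ _)).
    exact: (eta_nat (mon_on T)).
  have [f [fP _]] := @cz_univ _ _ Z (car M) (car W) x xnat.
  have fl N : (car (Q N) ◁ f) ∘ ld M N = lin (xi N).
    have E := f_equal lin (nat _ _ (counitM N)); rewrite !lin_comp !lin_tens !lin_idm in E.
    rewrite ldE compA -tensm_swap -compA -[_ ∘ d _ _]fP /x compA [X in X ∘ _ = _]E.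
    by rewrite -compA -tensmMr (act_eta N) tensm1 compm1.
  have lf : linear (M := lift_mod M) (N := W) f.
    by apply: lift_linear => N; rewrite fl; exact: lin_act.
  exists (@Build_LinHom C T (lift_mod M) W f lf); split.
    by move=> N; apply: lin_eq; rewrite -fl.
  move=> g gP; apply: lin_eq; apply: ld_ext => N.
  by rewrite fl (gP N).
Defined.

Lemma eqF_refl (A B : Category) (G : Functor A B) (e : G = G) (X : A) : eqF e X = idm (G X).
Proof. exact: eqh_id. Qed.

Lemma eqF_nat (A B : Category) (G H : Functor A B) (e : G = H) (X Y : A) (f : Hom X Y) :
  eqF e Y ∘ fmap G f = fmap H f ∘ eqF e X.
Proof. by subst H; rewrite !eqF_refl comp1m compm1. Qed.

(** The actions on morphisms have different types until the object maps are identified, hence the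
    comparison through [eqh]. *)
Lemma functor_eq (A B : Category) (G H : Functor A B) (eo : forall X, G X = H X) :
  (forall X Y (f : Hom X Y), eqh (eo Y) ∘ fmap G f = fmap H f ∘ eqh (eo X)) -> G = H.
Proof.
case: G H eo => o m a b [o' m' a' b'] /= eo.
have E : o = o' by exact: functional_extensionality_dep.
subst o' => em.
have {}em : m = m'.
  apply: functional_extensionality_dep => X; apply: functional_extensionality_dep => Y.
  apply: functional_extensionality_dep => f.
  by have := em X Y f; rewrite !eqh_id comp1m compm1.
by subst m'; rewrite (proof_irrelevance _ a a') (proof_irrelevance _ b b').
Qed.

Lemma centralizer_eq (A : MonCat) (P : Functor A A) (Z1 Z2 : Centralizer P)
    (e : cz Z1 = cz Z2) :
  (forall X Y, (P Y ◁ eqF e X) ∘ cz_map Z1 X Y = cz_map Z2 X Y) -> Z1 = Z2.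
Proof.
case: Z1 Z2 e => z m n u [z' m' n' u'] /= e; subst z' => em.
have {}em : m = m'.
  apply: functional_extensionality_dep => X; apply: functional_extensionality_dep => Y.
  by rewrite -em eqF_refl tensm1 comp1m.
by subst m'; rewrite (proof_irrelevance _ n n') (proof_irrelevance _ u u').
Qed.

Lemma lift_forget : forgetM T ∘F lift_cz = Z ∘F forgetM T.
Proof.
apply: (@functor_eq (ModMon T) C (forgetM T ∘F lift_cz) (Z ∘F forgetM T)
  (fun M => eq_refl (Z (car M)))) => M N f.
by rewrite /= comp1m compm1.
Qed.

Lemma lift_czP : is_centralizer_lift Z lift_cz.
Proof.
exists lift_forget => M N.
have -> : eqF lift_forget M = idm (Z (car M)) by exact: eqh_id.
by rewrite tensm1 comp1m -ldE.
Qed.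

Lemma lift_cz_unique (Z' : Centralizer Q) : is_centralizer_lift Z Z' -> lift_cz = Z'.
Proof.
move=> [e eP].
(* [ρ] is the identity from [Z M] to the carrier of [Z' M]. Its linearity, obtained from
   [lift_linear], says that the two actions on this object coincide. *)
pose ρ M := eqh (eq_sym (f_equal (fun K : Functor (ModMon T) C => K M) e))
  : Hom (Z (car M)) (car (Z' M)).
have ρE M : ρ M ∘ eqF e M = idm _ by exact: eqhK.
have ρP (M N : ModMon T) : (car (Q N) ◁ ρ M) ∘ ld M N = lin (cz_map Z' M N).
  by rewrite ldE -eP compA -tensmMr ρE tensm1 comp1m.
have ρl M : linear (M := lift_mod M) (N := Z' M) (ρ M).
  by apply: lift_linear => N; rewrite ρP; exact: lin_act.
have eo M : lift_mod M = Z' M by exact: (mod_eq (ρl M)).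
have le M : lin (eqh (eo M)) = ρ M by exact: lin_eqh.
have ef : cz lift_cz = cz Z'.
  apply: (@functor_eq (ModMon T) (ModMon T) lift_fun Z' eo) => M N f; apply: lin_eq.
  have en := eqF_nat e f.
  transitivity (ρ N ∘ fmap Z (lin f)).
    exact: (f_equal (fun k => k ∘ fmap Z (lin f)) (le N)).
  transitivity (lin (fmap Z' f) ∘ ρ M); last first.
    exact: (f_equal (fun k => lin (fmap Z' f) ∘ k) (eq_sym (le M))).
  have ρE' : eqF e M ∘ ρ M = idm _ by exact: eqhK.
  rewrite -[LHS]compm1 -ρE' !compA -(compA (ρ N)) -[fmap Z _ ∘ _]en compA ρE comp1m.
  by [].
apply: (@centralizer_eq (ModMon T) Q lift_cz Z' ef) => M N; apply: lin_eq.
rewrite -ρP lin_comp lin_tens; congr ((_ ⊗m _) ∘ _); exact: lin_eqh.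
Qed.

End LiftCentralizer.

(** Moves [a1] and [a2] out of a composite of two successive [∂]; it is applied with both equal to
    units [η]. *)
Lemma tail_shift {A : MonCat} (X Y1 Y2 V1 V2 P1 Z1 W : A) (f : Hom (X ⊗ V1) (P1 ⊗ Z1))
    (k : Hom (Z1 ⊗ V2) W) (a1 : Hom Y1 V1) (a2 : Hom Y2 V2) :
  (P1 ◁ (k ∘ (Z1 ◁ a2))) ∘ (assoc P1 Z1 Y2 ∘ ((f ∘ (X ◁ a1)) ▷ Y2) ∘ assoc' X Y1 Y2)
  = (P1 ◁ k) ∘ (assoc P1 Z1 V2 ∘ (f ▷ V2) ∘ assoc' X V1 V2) ∘ (X ◁ (a1 ⊗m a2)).
Proof.
rewrite tensmMr tensmMl !compA.
rewrite -(compA _ (assoc' X V1 V2)) assoc'_nat compA.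
crw (eq_sym (assoc_nat (idm P1) (idm Z1) a2)).
rewrite tensm1; crw (eq_sym (tensm_swap f a2)).
by rewrite -(tensm_rl (X ◁ a1) a2) ?compA.
Qed.

(** * Agreement of the lifted structures with those of the centralizer on the base *)

Section LiftStructures.
Context {C : AutCat} {T : HopfMonad C} {Q : Functor (ModMon T) (ModMon T)}.
Variable Z : Centralizer (cross Q).

Local Notation F := (freeM T).
Local Notation d := (cz_map Z).
Local Notation ZQ := (lift_cz Z).

Lemma lin_cz_map (M N : ModMon T) : lin (cz_map ZQ M N) = ld Z M N.
Proof. by []. Qed.

Lemma lin_dt (M N V : ModMon T) :
  lin (dt ZQ M N V) = assoc _ _ _ ∘ (ld Z M N ▷ car V) ∘ assoc' _ _ _.
Proof. by rewrite dtE !lin_comp lin_tens lin_assoc lin_assoc'. Qed.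

Lemma lin_cm2t (q : ComonoidalOn Q) (N1 N2 V : ModMon T) :
  lin (cm2t q N1 N2 V) = assoc _ _ _ ∘ (lin (cm2 q N1 N2) ▷ car V).
Proof. by rewrite cm2tE lin_comp lin_tens lin_assoc. Qed.

Lemma ld_free_tens (M : ModMon T) (Y1 Y2 : C) :
  (lin (fmap Q (free_cm2 (T := T) Y1 Y2)) ▷ Z (car M)) ∘ d (car M) (Y1 ⊗ Y2)
  = ld Z M (F Y1 ⊗ F Y2) ∘ (car M ◁ (η T Y1 ⊗m η T Y2)).
Proof.
rewrite -(ld_free Z M (Y1 ⊗ Y2)) compA ld_natr -compA -tensmMr.
congr (_ ∘ (_ ◁ _)); exact: (@free_ext C T (Y1 ⊗ Y2) (F Y1 ⊗ F Y2)).
Qed.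

(** The equation that determines the product of [Z_Q], taken at free modules and precomposed with
    units [η], is the one that determines the product of the centralizer of [cross Q]. *)
Lemma lift_mul (q : ComonoidalOn Q) (m : MonadOn Z) (mQ : MonadOn ZQ) (M : ModMon T) :
  is_centralizer_monad Z (cross_comon q) m -> is_centralizer_monad ZQ q mQ ->
  lin (mu mQ M) = mu m (car M).
Proof.
move=> [m2 _] [mQ2 _].
apply: (@dt2_ext C (cross Q) Z (@has_left_duals_autonomous C) (car M) (Z (car M))
  (lin (mu mQ M))) => Y1 Y2.
have e := proj2 (is_cz_mulE (cross_comon q) (mu m (car M))) (m2 (car M)) Y1 Y2.
rewrite [RHS]e dtE -tensmMr -(ld_free Z M Y1) -(ld_free Z (lift_mod Z M) Y2).
rewrite (compA (_ ◁ lin (mu mQ M))).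
have ts := tail_shift (ld Z M (F Y1)) ((car (Q (F Y2)) ◁ lin (mu mQ M))
  ∘ ld Z (lift_mod Z M) (F Y2)) (η T Y1) (η T Y2).
rewrite [LHS]ts.
have {}e := proj2 (is_cz_mulE q (mu mQ M)) (mQ2 M) (F Y1) (F Y2).
have {}e := f_equal lin e.
rewrite -tensmMr !lin_comp lin_tens lin_dt lin_cm2t lin_comp lin_tens !lin_idm in e.
rewrite [X in X ∘ _ = _]e cm2tE -!compA; congr (_ ∘ _).
(* The comonoidal structure of [cross Q] contains that of the free functor, which restricts along
   [η] to [η ⊗ η]. *)
have cc : cm2 (cross_comon q) Y1 Y2
    = lin (cm2 q (F Y1) (F Y2)) ∘ lin (fmap Q (free_cm2 (T := T) Y1 Y2)) by [].
by rewrite cc tensmMl -compA ld_free_tens.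
Qed.

Lemma lift_unit (q : ComonoidalOn Q) (m : MonadOn Z) (mQ : MonadOn ZQ) (M : ModMon T) :
  is_centralizer_monad Z (cross_comon q) m -> is_centralizer_monad ZQ q mQ ->
  lin (eta mQ M) = eta m (car M).
Proof.
move=> [_ m0] [_ mQ0]; rewrite m0 mQ0 !lin_comp lin_tens lin_lun lin_run' lin_idm.
have -> : cm0 (cross_comon q) = lin (cm0 q) ∘ lin (fmap Q (counitM (T := T) 𝟏)) by [].
rewrite tensmMl lin_cz_map ldE !compA; reflexivity.
Qed.

Lemma lift_cm2 (q : MonadOn Q) (c : ComonoidalOn Z) (cQ : ComonoidalOn ZQ) (M N : ModMon T) :
  is_centralizer_comon Z (cross_monad q) c -> is_centralizer_comon ZQ q cQ ->
  lin (cm2 cQ M N) = cm2 c (car M) (car N).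
Proof.
move=> [c2 _] [cQ2 _].
apply: (@cz_ext C (cross Q) Z (car M ⊗ car N) (Z (car M) ⊗ Z (car N)) (lin (cm2 cQ M N))) => Y.
rewrite [RHS]c2.
have := f_equal lin (cQ2 M N (F Y)).
rewrite !lin_comp !lin_tens !lin_assoc lin_assoc' !lin_idm !lin_cz_map => e.
have {}e := f_equal (fun k => k ∘ ((car M ⊗ car N) ◁ η T Y)) e.
rewrite -[LHS]compA (ld_free Z (M ⊗ N) Y) in e; rewrite [LHS]e.
have a := assoc_nat (idm (car M)) (idm (car N)) (η T Y); rewrite tensm1 in a.
have b := f_equal (fun k => car M ◁ k) (ld_free Z N Y); rewrite /= tensmMr in b.
(* The action of [Q (F Y)] in the product of [cross Q] is the one built into [ld] at the module
   [Q (F Y)]. *)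
have cc : mu (cross_monad q) Y = lin (mu q (F Y)) ∘ lin (fmap Q (counitM (Q (F Y)))) by [].
rewrite cc tensmMl ldE tensmMl ?compA; crw a; crw b.
crw (assoc_nat (lin (fmap Q (counitM (Q (F Y))))) (idm (Z (car M))) (idm (Z (car N)))).
rewrite tensm1; reflexivity.
Qed.

Lemma lift_cm0 (q : MonadOn Q) (c : ComonoidalOn Z) (cQ : ComonoidalOn ZQ) :
  is_centralizer_comon Z (cross_monad q) c -> is_centralizer_comon ZQ q cQ ->
  lin (cm0 cQ) = cm0 c.
Proof.
move=> [_ c0] [_ cQ0].
apply: (@cz_ext C (cross Q) Z 𝟏 𝟏 (lin (cm0 cQ))) => Y.
have e0 := proj2 (is_cz_cm0E (cross_monad q) (cm0 c)) c0 Y; rewrite [RHS]e0.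
have := f_equal lin (proj2 (is_cz_cm0E q (cm0 cQ)) cQ0 (F Y)).
rewrite !lin_comp !lin_tens lin_lun lin_run' !lin_idm lin_cz_map => e.
have {}e := f_equal (fun k => k ∘ (𝟏 ◁ η T Y)) e.
rewrite -[LHS]compA (ld_free Z (𝟏 : ModMon T) Y) in e; rewrite [LHS]e.
have a := lun_nat (η T Y); crw a; reflexivity.
Qed.

Lemma lift_monad_lift (q : ComonoidalOn Q) (m : MonadOn Z) (mQ : MonadOn ZQ) :
  is_centralizer_monad Z (cross_comon q) m -> is_centralizer_monad ZQ q mQ ->
  is_monad_lift m mQ.
Proof.
move=> hm hQ.
exists (eq_sym (lift_forget Z)).
have eE M : eqF (eq_sym (lift_forget Z)) M = idm (Z (car M)) by exact: eqh_id.
split=> M; rewrite eE comp1m.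
- rewrite eE fmap1 !compm1; symmetry; exact: (lift_mul M hm hQ).
- symmetry; exact: (lift_unit M hm hQ).
Qed.

Lemma comonFunctor_eq (A B : MonCat) (G H : Functor A B) (g : ComonoidalOn G)
    (h : ComonoidalOn H) (e : G = H) :
  (forall X Y, (eqF e X ⊗m eqF e Y) ∘ cm2 g X Y = cm2 h X Y ∘ eqF e (X ⊗ Y)) ->
  cm0 g = cm0 h ∘ eqF e 𝟏 ->
  {| cf_on := g |} = {| cf_on := h |} :> ComonFunctor A B.
Proof.
subst H => e2 e0; congr Build_ComonFunctor; apply: comonoidalOn_eq => [X Y|].
- by have := e2 X Y; rewrite !eqF_refl tensm1 comp1m compm1.
- by rewrite e0 eqF_refl compm1.
Qed.

Lemma lift_bimonad_lift (q : BimonadOn Q) (b : BimonadOn Z) (bQ : BimonadOn ZQ) :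
  is_centralizer_bimonad Z (cross_bimonad q) b -> is_centralizer_bimonad ZQ q bQ ->
  is_bimonad_lift b bQ.
Proof.
move=> [hm hc] [hmQ hcQ]; split; first exact: lift_monad_lift hm hmQ.
have eE M : eqF (lift_forget Z) M = idm (Z (car M)) by exact: eqh_id.
apply: (@comonFunctor_eq _ _ _ _ _ _ (lift_forget Z)) => [M N|].
- rewrite !eE tensm1 comp1m compm1 /= comp1m fmap1 compm1.
  exact: (lift_cm2 M N hc hcQ).
- rewrite eE compm1 /= comp1m fmap1 compm1.
  exact: (lift_cm0 hc hcQ).
Qed.

End LiftStructures.

Theorem theorem7p4 :
  forall (C : AutCat) (T : HopfMonad C) (Q : Functor (ModMon T) (ModMon T))
    (Z : Centralizer (cross Q)),
  (exists! ZQ : Centralizer Q, is_centralizer_lift Z ZQ) /\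
  (forall (ZQ : Centralizer Q) (q : ComonoidalOn Q), is_centralizer_lift Z ZQ ->
     exists (m : MonadOn Z) (mQ : MonadOn ZQ),
       unique (is_centralizer_monad Z (cross_comon q)) m /\
       unique (is_centralizer_monad ZQ q) mQ /\
       is_monad_lift m mQ) /\
  (forall (ZQ : Centralizer Q) (q : BimonadOn Q), is_centralizer_lift Z ZQ ->
     exists (b : BimonadOn Z) (bQ : BimonadOn ZQ),
       unique (is_centralizer_bimonad Z (cross_bimonad q)) b /\
       unique (is_centralizer_bimonad ZQ q) bQ /\
       is_bimonad_lift b bQ).
Proof.
move=> C T Q Z.
have hC := @has_left_duals_autonomous C; have hT := @has_left_duals_modules C T.
split; first by exists (lift_cz Z); split; [exact: lift_czP|exact: lift_cz_unique].
(* By uniqueness in the first part, the given lift may be taken to be [lift_cz Z], whose carriers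
   are by computation the objects [Z (car M)]. *)
split=> ZQ q /lift_cz_unique <-.
- exists (cz_monad Z hC (cross_comon q)), (cz_monad (lift_cz Z) hT q).
  have hm := cz_monadP Z hC (cross_comon q); have hQ := cz_monadP (lift_cz Z) hT q.
  split; last split.
  + by split=> // m; exact: (is_centralizer_monad_unique hC hm).
  + by split=> // m; exact: (is_centralizer_monad_unique hT hQ).
  + exact: lift_monad_lift hm hQ.
- exists (cz_bimonad Z hC (cross_bimonad q)), (cz_bimonad (lift_cz Z) hT q).
  have hb := cz_bimonadP Z hC (cross_bimonad q); have hQ := cz_bimonadP (lift_cz Z) hT q.
  split; last split.
  + by split=> // b; exact: (is_centralizer_bimonad_unique hC hb).
  + by split=> // b; exact: (is_centralizer_bimonad_unique hT hQ).
  + exact: lift_bimonad_lift hb hQ.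
Qed.
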